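(* Suppose that rings $R$ and $S$ contain $1/2$ and do not contain any central idempotents which are not equal to $1$ and $0$. Suppose that $V$ and $V'$ are free modules of infinite ranks over the rings $R$ and $S$, respectively. Then the groups $\mathrm{Aut}_R(V)$ and $\mathrm{Aut}_S(V')$ are elementarily equivalent if and only if the rings $\mathrm{End}_R(V)$ and $\mathrm{End}_S(V')$ are elementarily equivalent.
   Context: Rings are associative with unit; ''contains $1/2$'' means that $2$ is invertible in the ring. $\mathrm{End}_R(V)$ is the endomorphism ring and $\mathrm{Aut}_R(V)$ the automorphism group of the $R$-module $V$. Elementary equivalence of groups (rings) is with respect to the first order language of groups (rings). *)

(* Defs.v *)
From HB Require Import structures.
From mathcomp Require Import all_boot all_algebra.
From mathcomp Require Import boolp classical_sets cardinality.

Set Implicit Arguments.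
Unset Strict Implicit.
Unset Printing Implicit Defensive.

Import GRing.Theory.

(** * First-order logic with equality, over purely functional languages *)

Record language := Language { symbol : Type; arity : symbol -> nat }.

Inductive term (L : language) : Type :=
| Var of nat
| App (s : symbol L) of ('I_(arity s) -> term L).

(* The remaining connectives and the existential quantifier are classically
   definable from these. Variables are named by natural numbers. *)
Inductive formula (L : language) : Type :=
| Equal of term L & term L
| Falsum
| Implies of formula L & formula L
| Forall of nat & formula L.

Arguments Var {L}.
Arguments Falsum {L}.

Fixpoint occurs (L : language) (n : nat) (t : term L) : Prop :=
  match t with
  | Var k => k = n
  | App s args => exists i, occurs n (args i)
  end.

Fixpoint free_in (L : language) (n : nat) (phi : formula L) : Prop :=
  match phi with
  | Equal t u => occurs n t \/ occurs n u
  | Falsum => False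
  | Implies a b => free_in n a \/ free_in n b
  | Forall k a => k <> n /\ free_in n a
  end.

Definition sentence (L : language) (phi : formula L) : Prop :=
  forall n, ~ free_in n phi.

Record model (L : language) := Model {
  carrier :> Type;
  interp : forall s : symbol L, ('I_(arity s) -> carrier) -> carrier
}.

Fixpoint eval (L : language) (M : model L) (e : nat -> M) (t : term L) : M :=
  match t with
  | Var k => e k
  | App s args => interp (fun i => eval e (args i))
  end.

Fixpoint holds (L : language) (M : model L) (e : nat -> M)
    (phi : formula L) : Prop :=
  match phi with
  | Equal t u => eval e t = eval e u
  | Falsum => False
  | Implies a b => holds e a -> holds e b
  | Forall k a => forall x : M, holds (fun j => if j == k then x else e j) a
  end.

(* The valuation does not matter for a sentence, groups and rings being
   nonempty. *)
Definition satisfies (L : language) (M : model L) (phi : formula L) : Prop :=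
  forall e : nat -> M, holds e phi.

Definition elementarily_equivalent (L : language) (M N : model L) : Prop :=
  forall phi : formula L, sentence phi -> (satisfies M phi <-> satisfies N phi).

(** ** The language of groups *)

Inductive group_symbol := GOne | GInv | GMul.

Definition group_language : language :=
  Language (fun s => match s with GOne => 0 | GInv => 1 | GMul => 2 end).

Definition group_model (G : groupType) : model group_language :=
  @Model group_language G (fun s : group_symbol =>
    match s return ('I_(@arity group_language s) -> G) -> G with
    | GOne => fun _ => 1%g
    | GInv => fun x => (x ord0)^-1%g
    | GMul => fun x => (x ord0 * x ord_max)%g
    end).

Definition group_elem_equiv (G H : groupType) : Prop :=
  elementarily_equivalent (group_model G) (group_model H).

(** ** The language of rings *)

Local Open Scope ring_scope.

Inductive ring_symbol := RZero | ROne | ROpp | RAdd | RMul.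

Definition ring_language : language :=
  Language (fun s =>
    match s with RZero | ROne => 0 | ROpp => 1 | RAdd | RMul => 2 end%N).

Definition ring_model (A : pzRingType) : model ring_language :=
  @Model ring_language A (fun s : ring_symbol =>
    match s return ('I_(@arity ring_language s) -> A) -> A with
    | RZero => fun _ => 0
    | ROne => fun _ => 1
    | ROpp => fun x => - x ord0
    | RAdd => fun x => x ord0 + x ord_max
    | RMul => fun x => x ord0 * x ord_max
    end).

Definition ring_elem_equiv (A B : pzRingType) : Prop :=
  elementarily_equivalent (ring_model A) (ring_model B).

(** * Rings *)

Definition contains_half (R : pzRingType) : Prop :=
  exists h : R, h * 2%:R = 1 /\ 2%:R * h = 1.

Definition no_nontrivial_central_idempotent (R : pzRingType) : Prop :=
  forall e : R, e * e = e -> (forall x : R, GRing.comm e x) -> e = 0 \/ e = 1.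

(** * Free modules of infinite rank *)

Definition is_basis (R : pzRingType) (V : lmodType R) (I : choiceType)
    (b : I -> V) : Prop :=
  (forall v : V, exists (s : seq I) (c : I -> R),
     v = \sum_(i <- s) c i *: b i) /\
  (forall (s : seq I) (c : I -> R), uniq s ->
     \sum_(i <- s) c i *: b i = 0 -> {in s, forall i, c i = 0}).

(* A module with an infinite basis is not finitely generated (over a nonzero
   ring), so all its bases are infinite: this does not depend on the basis. *)
Definition free_of_infinite_rank (R : pzRingType) (V : lmodType R) : Prop :=
  exists (I : choiceType) (b : I -> V),
    infinite_set [set: I]%classic /\ is_basis b.

(** * The endomorphism ring, with composition as multiplication *)

Definition End (R : pzRingType) (V : lmodType R) : Type := {linear V -> V}.

Section EndRing.
Variables (R : pzRingType) (V : lmodType R).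
Implicit Types f g h : End V.

HB.instance Definition _ := gen_eqMixin (End V).
HB.instance Definition _ := gen_choiceMixin (End V).

Definition End_fun f : V -> V := (f : {linear V -> V}).
Coercion End_fun : End >-> Funclass.

Lemma End_ext f g : (forall v, f v = g v) -> f = g.
Proof.
rewrite /End_fun.
case: f g => f [[fA] [fZ]] [g [[gA] [gZ]]] /= /funext efg.
subst g; congr (GRing.Linear.Pack (GRing.Linear.Class _ _));
  by congr (_ _); exact: Prop_irrelevance.
Qed.

Definition End_zero : End V := (\0 : {linear V -> V}).
Definition End_opp f : End V :=
  (\- (f : {linear V -> V}) : {linear V -> V}).
Definition End_add f g : End V :=
  ((f : {linear V -> V}) \+ (g : {linear V -> V}) : {linear V -> V}).
Definition End_one : End V := (idfun : {linear V -> V}).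
Definition End_mul f g : End V :=
  ((f : {linear V -> V}) \o (g : {linear V -> V}) : {linear V -> V}).

Lemma End_addA : associative End_add.
Proof. by move=> f g h; apply: End_ext => v; exact: addrA. Qed.
Lemma End_addC : commutative End_add.
Proof. by move=> f g; apply: End_ext => v; exact: addrC. Qed.
Lemma End_add0 : left_id End_zero End_add.
Proof. by move=> f; apply: End_ext => v; exact: add0r. Qed.
Lemma End_addN : left_inverse End_zero End_opp End_add.
Proof. by move=> f; apply: End_ext => v; exact: addNr. Qed.
Lemma End_mulA : associative End_mul.
Proof. by move=> f g h; apply: End_ext. Qed.
Lemma End_mul1l : left_id End_one End_mul.
Proof. by move=> f; apply: End_ext. Qed.
Lemma End_mul1r : right_id End_one End_mul.
Proof. by move=> f; apply: End_ext. Qed.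
Lemma End_mulDl : left_distributive End_mul End_add.
Proof. by move=> f g h; apply: End_ext. Qed.
Lemma End_mulDr : right_distributive End_mul End_add.
Proof.
move=> f g h; apply: End_ext => v.
exact: (raddfD (f : {linear V -> V})).
Qed.

HB.instance Definition _ := GRing.isZmodule.Build (End V)
  End_addA End_addC End_add0 End_addN.
HB.instance Definition _ := GRing.Zmodule_isPzRing.Build (End V)
  End_mulA End_mul1l End_mul1r End_mulDl End_mulDr.

End EndRing.

(** * The automorphism group *)

(* A linear bijection bundled with its inverse; the inverse being determined by
   the map, equality is equality of the underlying maps (Aut_ext). *)
Record Aut (R : pzRingType) (V : lmodType R) : Type := MkAut {
  aut_fun : {linear V -> V};
  aut_inv : {linear V -> V};
  aut_funK : cancel aut_fun aut_inv;
  aut_invK : cancel aut_inv aut_fun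
}.

Section AutGroup.
Variables (R : pzRingType) (V : lmodType R).
Implicit Types f g h : Aut V.

HB.instance Definition _ := gen_eqMixin (Aut V).
HB.instance Definition _ := gen_choiceMixin (Aut V).

Lemma Aut_ext f g : aut_fun f =1 aut_fun g -> f = g.
Proof.
case: f g => f f' fK fK' [g g' gK gK'] /= efg.
have {}efg : f = g by exact: (@End_ext _ _ f g).
subst g; have e : f' = g'.
  by apply: (@End_ext _ _ f' g') => v; rewrite /End_fun -[in RHS](fK' v) gK.
by subst g'; congr MkAut; exact: Prop_irrelevance.
Qed.

Definition Aut_one : Aut V :=
  @MkAut R V (idfun : {linear V -> V}) (idfun : {linear V -> V})
    (fun=> erefl) (fun=> erefl).
Definition Aut_inv f : Aut V := MkAut (aut_invK f) (aut_funK f).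
Definition Aut_mul f g : Aut V :=
  @MkAut R V (aut_fun f \o aut_fun g : {linear V -> V})
    (aut_inv g \o aut_inv f : {linear V -> V})
    (can_comp (aut_funK f) (aut_funK g)) (can_comp (aut_invK g) (aut_invK f)).

Lemma Aut_mulA : associative Aut_mul.
Proof. by move=> f g h; apply: Aut_ext. Qed.
Lemma Aut_mul1l : left_id Aut_one Aut_mul.
Proof. by move=> f; apply: Aut_ext. Qed.
Lemma Aut_mul1r : right_id Aut_one Aut_mul.
Proof. by move=> f; apply: Aut_ext. Qed.
Lemma Aut_mulVl : left_inverse Aut_one Aut_inv Aut_mul.
Proof. by move=> f; apply: Aut_ext => v; exact: aut_funK. Qed.
Lemma Aut_mulVr : right_inverse Aut_one Aut_inv Aut_mul.
Proof. by move=> f; apply: Aut_ext => v; exact: aut_invK. Qed.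

HB.instance Definition _ := isGroup.Build (Aut V)
  Aut_mulA Aut_mul1l Aut_mul1r Aut_mulVl Aut_mulVr.

End AutGroup.

(* Main.v *)
(** The units of [E = End V] include enough transvections to recover [E]: a
    group tuple satisfying the formula [good] consists of involutions [1 - 2
    e_i] for a decomposition [1 = e_0 + e_1 + e_2] and of elements [x_ij]
    satisfying Steinberg relations. Each [x_ij] splits as [1 + b_ij + c_ij],
    the [b] being matrix units and the [c] matrix units with products
    reversed, up to sign; as [E] has no nontrivial central idempotent, the
    [b] or the [c] vanish. Since [V] is isomorphic to [V + V], the root
    subgroup of [x_02], with multiplication given by commutators, is then a
    copy of [E] or of its opposite. A first-order sentence on rings,
    [oriented], is true in [E] and false in the opposite ring: it expresses
    that the shift [t] on countably many copies of [V] is locally nilpotent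
    without being nilpotent, which is possible only on one side since
    vectors have finite support. Adding it to the conditions on the tuple
    yields a uniform interpretation of [E] in [Aut V]. Conversely, units are
    definable in a ring. *)

(* Inversion maps the unit group of E onto that of the opposite ring. So the conditions on the
   tuple, being group-theoretic, are also met by a mirror-image tuple, with 1 - e_ji in place of 1 +
   e_ij, which codes the opposite ring. The choice between the two must come from a ring property,
   read through the code itself.

   Quantification over n is replaced by definable sets Z that contain 1 and are closed under right
   multiplication by t: each of them contains all powers, and in the opposite ring the parameters
   can be chosen so that Z consists of the powers only.

   The element 1/2 serves twice. It turns an involution eps into the idempotent (1 - eps)/2, and it
   undoes a doubling: if eps inverts g, then g eps g^-1 eps is the square of g, which doubles an
   off-diagonal entry. Three blocks are needed for a root element to be a commutator of two
   others. *)
Require Import Defs.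
From HB Require Import structures.
From mathcomp Require Import all_boot all_algebra.
From mathcomp Require Import boolp classical_sets functions cardinality.
From Stdlib Require Ncring_tac.

Set Implicit Arguments.
Unset Strict Implicit.
Unset Printing Implicit Defensive.

Import GRing.Theory.

(** * The noncommutative ring tactic for MathComp rings *)

Section NoncommutativeRing.
Local Open Scope ring_scope.
Variable A : pzRingType.

#[global] Instance pzRing_ncring_ops :
  @Ncring.Ring_ops A 0 1 +%R *%R (fun x y => x - y) -%R (@eq A) := {}.

Lemma pzRing_ncring_axioms :
  @Ncring.Ring A 0 1 +%R *%R (fun x y => x - y) -%R (@eq A) pzRing_ncring_ops.
Proof.
apply: Ncring.Build_Ring;
  rewrite /Algebra_syntax.addition /Ncring.add_notation
    /Algebra_syntax.multiplication /Ncring.mul_notation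
    /Algebra_syntax.zero /Ncring.zero_notation
    /Algebra_syntax.one /Ncring.one_notation
    /Algebra_syntax.opposite /Ncring.opp_notation
    /Algebra_syntax.equality /Ncring.eq_notation
    /Algebra_syntax.subtraction /Ncring.sub_notation.
all: first [exact: add0r | exact: addrC | exact: addrA | exact: mul1r
  | exact: mulr1 | exact: mulrA | exact: mulrDl
  | by move=> x y z; exact: mulrDr | by [] | exact: subrr
  | by move=> x y -> z t -> | by move=> x y -> | idtac].
Qed.
#[global] Existing Instance pzRing_ncring_axioms.
End NoncommutativeRing.

Ltac ncring := Ncring_tac.non_commutative_ring.

(** * First-order logic *)

Section FirstOrder.
Variable L : language.
Implicit Types (t : term L) (phi : formula L) (M : model L).

Definition updv (T : Type) (e : nat -> T) (k : nat) (x : T) : nat -> T :=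
  fun j => if j == k then x else e j.

Lemma updv_id (T : Type) (e : nat -> T) k : updv e k (e k) = e.
Proof. by apply/funext => j; rewrite /updv; case: eqP => [->|]. Qed.

Lemma eval_ext M (e e' : nat -> M) t :
  (forall n, occurs n t -> e n = e' n) -> eval e t = eval e' t.
Proof.
elim: t => [k|s args IH] /= ee; first exact: ee.
congr (interp _); apply/funext => i; apply: IH => n oc.
by apply: ee; exists i.
Qed.

Lemma holds_ext M phi : forall e e' : nat -> M,
  (forall n, free_in n phi -> e n = e' n) -> (holds e phi <-> holds e' phi).
Proof.
elim: phi => [t u|//|a IHa b IHb|k a IH] e e' /= ee.
- by rewrite (eval_ext (fun n oc => ee n (or_introl oc)))
             (eval_ext (fun n oc => ee n (or_intror oc))).
- have Ha := IHa e e' (fun n f => ee n (or_introl f)).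
  have Hb := IHb e e' (fun n f => ee n (or_intror f)).
  by rewrite Ha Hb.
- have H x : holds (updv e k x) a <-> holds (updv e' k x) a.
    apply: IH => n fn; rewrite /updv; case: eqP => // nk.
    by apply: ee; split=> // kn; apply: nk.
  by split=> h x; apply/H; exact: h.
Qed.

Fixpoint term_bound t : nat :=
  match t with
  | Var k => k.+1
  | App s args => \max_(i < arity s) term_bound (args i)
  end.

Lemma term_boundP n t : occurs n t -> n < term_bound t.
Proof.
elim: t => [k <- //|s args IH] /= [i oc].
exact: leq_trans (IH i oc) (leq_bigmax i).
Qed.

Lemma free_bounded phi : exists N, forall n, free_in n phi -> n < N.
Proof.
elim: phi => [t u||a [Na Ha] b [Nb Hb]|k a [N H]] /=.
- exists (maxn (term_bound t) (term_bound u)) => n.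
  by rewrite leq_max => -[]/term_boundP ->; rewrite ?orbT.
- by exists 0.
- exists (maxn Na Nb) => n; rewrite leq_max.
  by case=> [/Ha ->|/Hb ->]; rewrite ?orbT.
- by exists N => n [_ /H].
Qed.

Fixpoint univ_closure (n : nat) phi : formula L :=
  if n is k.+1 then Forall k (univ_closure k phi) else phi.

Lemma free_in_closure j n phi :
  free_in j (univ_closure n phi) -> free_in j phi /\ n <= j.
Proof.
elim: n => //= n IH [nj /IH[? nlej]]; split=> //.
by rewrite ltn_neqAle nlej andbT; apply/eqP.
Qed.

Lemma satisfies_closure M n phi : satisfies M (univ_closure n phi) <-> satisfies M phi.
Proof.
elim: n => //= n IH; split=> [h|/IH h] => [|e x]; last exact: h.
by apply/IH => e; move: (h e (e n)); rewrite -/(updv e n (e n)) updv_id.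
Qed.

(** Universal closure frees later arguments from checking that translated formulas are sentences; in
    particular the parameters of an interpretation may stay free variables. *)
Lemma elem_equiv_satisfies (M N : model L) : elementarily_equivalent M N ->
  forall phi, satisfies M phi <-> satisfies N phi.
Proof.
move=> MN phi; have [n phin] := free_bounded phi.
rewrite -(satisfies_closure M n) -(satisfies_closure N n).
by apply: MN => j /free_in_closure[/phin]; rewrite ltnNge => /negP.
Qed.

Lemma satisfies_sentence M phi (e : nat -> M) :
  sentence phi -> (satisfies M phi <-> holds e phi).
Proof.
move=> sphi; split=> [/(_ e)//|h e']; apply: (iffLR (@holds_ext M phi e e' _) h) => n.
by move/sphi.
Qed.

Definition FNot phi := Defs.Implies phi (@Falsum L).
Definition FAnd phi psi := FNot (Defs.Implies phi (FNot psi)).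
Definition FOr phi psi := Defs.Implies (FNot phi) psi.
Definition FEx k phi := FNot (Forall k (FNot phi)).
Definition FAll (I : finType) (F : I -> formula L) :=
  foldr FAnd (FNot (@Falsum L)) [seq F i | i <- enum I].

Lemma holds_and M (e : nat -> M) phi psi :
  holds e (FAnd phi psi) <-> (holds e phi /\ holds e psi).
Proof.
rewrite /=; split=> [h|[hp hq] h]; last exact: h.
by split; apply: contrapT => ?; apply: h.
Qed.

Lemma holds_or M (e : nat -> M) phi psi :
  holds e (FOr phi psi) <-> (holds e phi \/ holds e psi).
Proof.
rewrite /=; split=> [h|[]// ? /(_ _)[]].
by have [?|?] := EM (holds e phi); [left|right; apply: h].
Qed.

Lemma holds_ex M (e : nat -> M) k phi :
  holds e (FEx k phi) <-> (exists x, holds (updv e k x) phi).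
Proof.
rewrite /=; split=> [h|[x hx] h]; last exact: (h x).
by apply: contrapT => nh; apply: h => x hx; apply: nh; exists x.
Qed.

Lemma holds_all (I : finType) M (e : nat -> M) (F : I -> formula L) :
  holds e (FAll F) <-> (forall i, holds e (F i)).
Proof.
have H s : holds e (foldr FAnd (FNot (@Falsum L)) [seq F i | i <- s]) <->
    (forall i, i \in s -> holds e (F i)).
  elim: s => [|i s IH]; first by split=> [_ i|_ []].
  rewrite [foldr _ _ _]/= holds_and IH; split=> [[hi hs] j|h].
    by rewrite inE => /orP[/eqP->|/hs].
  by split=> [|j js]; apply: h; rewrite inE ?eqxx ?js ?orbT.
rewrite H; split=> h i; first by apply: h; rewrite mem_enum.
by move=> _; apply: h.
Qed.

End FirstOrder.

Definition gone : term group_language := @App group_language GOne (fun=> Var 0).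
Definition ginv (t : term group_language) : term group_language :=
  @App group_language GInv (fun=> t).
Definition gmul (t u : term group_language) : term group_language :=
  @App group_language GMul (fun i => if nat_of_ord i is 0 then t else u).
Definition gcomm t u := gmul (gmul t u) (ginv (gmul u t)).

Definition rzero : term ring_language := @App ring_language RZero (fun=> Var 0).
Definition rone : term ring_language := @App ring_language ROne (fun=> Var 0).
Definition rmul (t u : term ring_language) : term ring_language :=
  @App ring_language RMul (fun i => if nat_of_ord i is 0%N then t else u).

(** * Idempotents and Steinberg relations *)

Local Open Scope ring_scope.

Definition distinct3 (i j k : 'I_3) := [&& i != j, i != k & j != k].

Lemma distinct3_sum (A : zmodType) (F : 'I_3 -> A) i j k : distinct3 i j k ->
  F i + F j + F k = \sum_i F i.
Proof.
case/and3P=> ij ik jk; rewrite (bigD1 i) //= (bigD1 j) 1?eq_sym //=.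
rewrite (bigD1 k) /=; last by rewrite ![k == _]eq_sym ik jk.
rewrite big_pred0 ?addr0 ?addrA // => l.
case: i j k l ij ik jk => [[|[|[|//]]] ?] [[|[|[|//]]] ?] [[|[|[|//]]] ?].
all: by case=> [[|[|[|//]]] ?].
Qed.

Lemma third_index (i j : 'I_3) : i != j -> exists k, distinct3 i j k.
Proof.
pose a : 'I_3 := @Ordinal 3 0 isT; pose b := @Ordinal 3 1 isT.
pose c := @Ordinal 3 2 isT.
case: i j => [[|[|[|//]]] ?] [[|[|[|//]]] ?] // _;
  by [exists a | exists b | exists c].
Qed.

Lemma distinct3P i j k : distinct3 i j k ->
  (i != j) * (j != i) * (i != k) * (k != i) * (j != k) * (k != j).
Proof. by case/and3P=> ij ik jk; rewrite ![_ == i]eq_sym [k == j]eq_sym ij ik jk. Qed.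

Lemma distinct3F i j k : distinct3 i j k ->
  ((i == j = false) * (j == i = false) * (i == k = false) * (k == i = false) *
   (j == k = false) * (k == j = false))%type.
Proof. by move/distinct3P=> D; do !split; apply/negbTE; rewrite D. Qed.

Lemma distinct3_perm i j k : distinct3 i j k ->
  (distinct3 i k j * distinct3 j i k * distinct3 j k i *
   distinct3 k i j * distinct3 k j i)%type.
Proof. by move=> /distinct3P d; rewrite /distinct3 !d. Qed.

Definition orthogonal_decomposition (A : pzRingType) (e : 'I_3 -> A) :=
  (forall i j, e i * e j = if i == j then e i else 0) /\ \sum_i e i = 1.

Section Blocks.
Variables (A : pzRingType) (e : 'I_3 -> A).
Hypothesis eP : orthogonal_decomposition e.

Lemma odec_id i : e i * e i = e i. Proof. by rewrite eP.1 eqxx. Qed.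
Lemma odec_0 i j : i != j -> e i * e j = 0.
Proof. by rewrite eP.1 => /negbTE ->. Qed.
Lemma odec_0K i j a : i != j -> e i * (e j * a) = 0.
Proof. by move=> ij; rewrite mulrA odec_0 ?mul0r. Qed.
Lemma odec_split i j k a b : distinct3 i j k ->
  a * b = a * e i * b + a * e j * b + a * e k * b.
Proof. by move=> d; rewrite -!mulrDl -!mulrDr (distinct3_sum e d) eP.2 mulr1. Qed.

Lemma odec_ext i j k a b : distinct3 i j k ->
  a * e i = b * e i -> a * e j = b * e j -> a * e k = b * e k -> a = b.
Proof.
by move=> d hi hj hk; rewrite -[a]mulr1 -[b]mulr1 -eP.2 -(distinct3_sum e d)
  !mulrDr hi hj hk.
Qed.

Definition fixes (x : A) k := x * e k = e k /\ e k * x = e k.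

(* x, y, z stand for x_ij, x_jk, x_ik, and primes for inverses. *)
Lemma commutator_diag i j k (x y z x' y' z' : A) : distinct3 i j k ->
  fixes x k -> fixes y i -> fixes z j -> fixes z' j ->
  x * x' = 1 -> y * y' = 1 -> z' * z = 1 ->
  z * x = x * z -> z * y = y * z -> x * y = z * (y * x) ->
  e i * z' * e i = e i * z * e i ->
  e i * z * e i = e i /\ e k * z * e k = e k.
Proof.
move=> d [xk kx] [yi iy] [zj jz] [z'j jz'] xx' yy' z'z zx zy xy zi.
have D := distinct3P d.
have iz'x l : l != k -> e i * z' * x * e l = e i * z' * e i * x * e l.
  move=> lk; rewrite -mulrA (@odec_split i j k _ (x * _) d).
  rewrite -[e i * z' * e j]mulrA z'j odec_0 ?D // mul0r addr0.
  rewrite -[_ * e k * _]mulrA [e k * _]mulrA kx odec_0 1?eq_sym // mulr0 addr0.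
  by rewrite !mulrA.
have izx l : l != k -> e i * z * x * e l = e i * z * e i * x * e l.
  move=> lk; rewrite -mulrA (@odec_split i j k _ (x * _) d).
  rewrite -[e i * z * e j]mulrA zj odec_0 ?D // mul0r addr0.
  rewrite -[_ * e k * _]mulrA [e k * _]mulrA kx odec_0 1?eq_sym // mulr0 addr0.
  by rewrite !mulrA.
have kzy l : l != i -> e k * z * y * e l = e k * z * e k * y * e l.
  move=> li; rewrite -mulrA (@odec_split i j k _ (y * _) d).
  rewrite -[e k * z * e j]mulrA zj odec_0 ?D // mul0r addr0.
  rewrite -[_ * e i * _]mulrA [e i * _]mulrA iy odec_0 1?eq_sym // mulr0 add0r.
  by rewrite !mulrA.
have zxy : z' * x * y = y * x by rewrite -mulrA xy mulrA z'z mul1r.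
split.
  (* The element [e i * z * e i] acts as the identity on the row [e i * x]: on column i because
     [z' * x * y = y * x] and y fixes block i, on column j because z commutes with x and fixes block
     j, on column k because the row vanishes there. Cancelling the invertible x gives the claim; the
     second half treats the row [e k * y] in the same way. *)
  have H1 : e i * z * e i * x * e i = e i * x * e i.
    rewrite -zi -iz'x ?D //.
    transitivity (e i * (z' * x * y) * e i); last by rewrite zxy mulrA iy.
    by rewrite !mulrA -[_ * y * _]mulrA yi.
  have H2 : e i * z * e i * x * e j = e i * x * e j.
    by rewrite -izx ?D // -[e i * z * x]mulrA zx mulrA -mulrA zj.
  have H3 : e i * z * e i * x = e i * x.
    by apply: (odec_ext d) => //; rewrite -!mulrA xk odec_0 ?D // !mulr0.
  by rewrite -[LHS]mulr1 -xx' mulrA H3 -mulrA xx' mulr1.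
have H1 : e k * z * e k * y * e k = e k * y * e k.
  rewrite -kzy ?D //.
  transitivity (e k * (z * (y * x)) * e k); last by rewrite -xy mulrA kx.
  by rewrite !mulrA -[_ * x * _]mulrA xk.
have H2 : e k * z * e k * y * e j = e k * y * e j.
  by rewrite -kzy ?D // -[e k * z * y]mulrA zy mulrA -mulrA zj.
have H3 : e k * z * e k * y = e k * y.
  by apply: (odec_ext d) => //; rewrite -!mulrA yi odec_0 ?D // !mulr0.
by rewrite -[LHS]mulr1 -yy' mulrA H3 -mulrA yy' mulr1.
Qed.

Definition refl i := 1 - e i - e i.

Lemma refl_mulr_id i : refl i * e i = - e i.
Proof. by rewrite /refl !mulrBl mul1r odec_id subrr sub0r. Qed.
Lemma refl_mull_id i : e i * refl i = - e i.
Proof. by rewrite /refl !mulrBr mulr1 odec_id subrr sub0r. Qed.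
Lemma refl_mulr_0 i j : i != j -> refl i * e j = e j.
Proof. by move=> ij; rewrite /refl !mulrBl mul1r odec_0 // !subr0. Qed.
Lemma refl_mull_0 i j : i != j -> e j * refl i = e j.
Proof. by move=> ij; rewrite /refl !mulrBr mulr1 odec_0 1?eq_sym // !subr0. Qed.

(** Only [st_weyl] links x_ij with the opposite root x_ji: it keeps one consequence of the fact that
    the Weyl element exchanges blocks i and j. *)
Record steinberg (x x' : 'I_3 -> 'I_3 -> A) : Prop := Steinberg {
  st_mulV : forall i j, i != j -> x i j * x' i j = 1;
  st_mulVl : forall i j, i != j -> x' i j * x i j = 1;
  st_fix : forall i j k, distinct3 i j k -> fixes (x i j) k;
  st_inv : forall i j, i != j -> x' i j = refl i * x i j * refl i;
  st_comm : forall i j k, distinct3 i j k ->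
    x i j * x j k = x i k * (x j k * x i j);
  st_row : forall i j k, distinct3 i j k -> x i j * x i k = x i k * x i j;
  st_col : forall i j k, distinct3 i j k -> x i k * x j k = x j k * x i k;
  st_weyl : forall i j, i != j ->
    e i * (x i j * x' j i * x i j) * e i = 0 }.

Section Steinberg.
Variables x x' : 'I_3 -> 'I_3 -> A.
Hypothesis xP : steinberg x x'.

Fact root_key : unit. Proof. by []. Qed.
Definition rootp i j := locked_with root_key (e i * x i j * e j).
Definition rootn i j := locked_with root_key (e j * x i j * e i).
Local Notation b := rootp.
Local Notation c := rootn.

Lemma st_fixV i j k : distinct3 i j k -> fixes (x' i j) k.
Proof.
move=> d; have [xk kx] := st_fix xP d; have D := distinct3P d.
split; first by rewrite -[in LHS]xk mulrA (st_mulVl xP) ?D // mul1r.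
by rewrite -[in LHS]kx -mulrA (st_mulV xP) ?D // mulr1.
Qed.

Lemma st_diag i k : i != k -> e i * x i k * e i = e i /\ e k * x i k * e k = e k.
Proof.
case/third_index=> j /distinct3_perm d'.
have dd : distinct3 i j k by rewrite d'.
have D := distinct3P dd; have d := distinct3_perm dd.
apply: (@commutator_diag i j k (x i j) (x j k) (x i k) (x' i j) (x' j k) (x' i k)).
- by [].
- exact: (st_fix xP).
- by apply: (st_fix xP); rewrite d.
- by apply: (st_fix xP); rewrite d.
- by apply: st_fixV; rewrite d.
- by apply: (st_mulV xP); rewrite D.
- by apply: (st_mulV xP); rewrite D.
- by apply: (st_mulVl xP); rewrite D.
- by rewrite (st_row xP) // d.
- by rewrite (st_col xP).
- exact: (st_comm xP).
- rewrite (st_inv xP) ?D // !mulrA refl_mull_id !mulNr -mulrA.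
  by rewrite refl_mulr_id mulrN opprK.
Qed.

Lemma rootpE i j : (e i * b i j = b i j) * (b i j * e j = b i j).
Proof. by rewrite /b unlock !mulrA odec_id -!mulrA odec_id. Qed.
Lemma rootnE i j : (e j * c i j = c i j) * (c i j * e i = c i j).
Proof. by rewrite /c unlock !mulrA odec_id -!mulrA odec_id. Qed.

Lemma mule0 a k l : a * e k = a -> k != l -> a * e l = 0.
Proof. by move=> <- kl; rewrite -mulrA odec_0 // mulr0. Qed.
Lemma emul0 a k l : e k * a = a -> k != l -> e l * a = 0.
Proof. by move=> <- kl; rewrite odec_0K // eq_sym. Qed.
Lemma mule_mul0 a a' k l : a * e k = a -> e l * a' = a' -> k != l -> a * a' = 0.
Proof. by move=> <- <- kl; rewrite -mulrA odec_0K // mulr0. Qed.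

Lemma st_unip i j : i != j -> x i j = 1 + b i j + c i j.
Proof.
move=> ij; have [k d] := third_index ij; have D := distinct3P d.
have [di dj] := st_diag ij; have [xk kx] := st_fix xP d.
have H l : x i j * e l = e i * x i j * e l + e j * x i j * e l + e k * x i j * e l.
  by rewrite -!mulrDl (distinct3_sum e d) eP.2 mul1r.
have bE : e i * x i j * e j = b i j by rewrite /b unlock.
have cE : e j * x i j * e i = c i j by rewrite /c unlock.
apply: (odec_ext d); rewrite H !mulrDl mul1r kx.
- rewrite di cE (odec_0 (i:=k)) ?D // (mule0 (rootpE i j).2) ?D //.
  by rewrite (rootnE i j).2 !addr0.
- rewrite dj bE (odec_0 (i:=k)) ?D // (mule0 (rootnE i j).2) ?D //.
  by rewrite (rootpE i j).2 !addr0 addrC.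
- rewrite odec_id -[e i * _ * e k]mulrA -[e j * _ * e k]mulrA xk.
  rewrite (odec_0 (i:=i)) ?D // (odec_0 (i:=j)) ?D //.
  by rewrite (mule0 (rootpE i j).2) ?D // (mule0 (rootnE i j).2) ?D // !addr0 !add0r.
Qed.

Lemma st_unipV i j : i != j -> x' i j = 1 - b i j - c i j.
Proof.
move=> ij; have ji : j != i by rewrite eq_sym.
rewrite (st_inv xP) // st_unip //.
have rr : refl i * refl i = 1.
  have reflE : refl i = 1 - e i - e i by [].
  rewrite {1}reflE !mulrBl mul1r refl_mull_id opprK.
  by rewrite reflE !subrK.
have rb : refl i * b i j * refl i = - b i j.
  by rewrite -(rootpE i j).1 mulrA refl_mulr_id !mulNr (rootpE i j).1
    -(rootpE i j).2 -mulrA refl_mull_0.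
have rc : refl i * c i j * refl i = - c i j.
  have -> : refl i * c i j = c i j.
    by rewrite -{1}(rootnE i j).1 mulrA refl_mulr_0 // (rootnE i j).1.
  by rewrite -{1}(rootnE i j).2 -mulrA refl_mull_id mulrN (rootnE i j).2.
transitivity (refl i * refl i + refl i * b i j * refl i + refl i * c i j * refl i).
  by move: (refl i) (b i j) (c i j) => r u v; ncring.
by rewrite rr rb rc.
Qed.

(** In [x i j * x' i j = 1] only the sum of the two products survives; they lie in the corners of
    [e i] and [e j], so each vanishes. *)
Lemma root_sq i j : i != j -> b i j * c i j = 0 /\ c i j * b i j = 0.
Proof.
move=> ij; have := st_mulV xP ij; rewrite st_unip // st_unipV //.
have ji : j != i by rewrite eq_sym.
have bb : b i j * b i j = 0 by exact: mule_mul0 (rootpE i j).2 (rootpE i j).1 _.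
have cc : c i j * c i j = 0 by exact: mule_mul0 (rootnE i j).2 (rootnE i j).1 _.
have -> : (1 + b i j + c i j) * (1 - b i j - c i j) =
  1 - b i j * b i j - c i j * c i j - (b i j * c i j + c i j * b i j) by ncring.
rewrite bb cc !subr0 => /eqP; rewrite -subr_eq0 addrAC subrr sub0r oppr_eq0.
move=> /eqP H; split.
  have := congr1 (fun a => e i * a) H; rewrite mulr0 mulrDr !mulrA (rootpE i j).1.
  by rewrite (emul0 (rootnE i j).1) // mul0r addr0.
have := congr1 (fun a => e j * a) H; rewrite mulr0 mulrDr !mulrA (rootnE i j).1.
by rewrite (emul0 (rootpE i j).1) // mul0r add0r.
Qed.

Lemma st_el i j : i != j -> e i * x i j = e i + b i j.
Proof.
move=> ij; rewrite st_unip // !mulrDr mulr1 (rootpE i j).1.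
by rewrite (emul0 (rootnE i j).1) 1?eq_sym // addr0.
Qed.
Lemma st_er i j : i != j -> x i j * e j = e j + b i j.
Proof.
move=> ij; rewrite st_unip // !mulrDl mul1r (rootpE i j).2.
by rewrite (mule0 (rootnE i j).2) // addr0.
Qed.
Lemma st_eln i j : i != j -> e j * x i j = e j + c i j.
Proof.
move=> ij; rewrite st_unip // !mulrDr mulr1 (rootnE i j).1.
by rewrite (emul0 (rootpE i j).1) // addr0.
Qed.
Lemma st_ern i j : i != j -> x i j * e i = e i + c i j.
Proof.
move=> ij; rewrite st_unip // !mulrDl mul1r (rootnE i j).2.
by rewrite (mule0 (rootpE i j).2) 1?eq_sym // addr0.
Qed.

(** The [b] multiply like matrix units e_ij and the [c] like -e_ji, and all composable mixed
    products vanish. By [sr_full] the identity of each block is cut into a part carried by [b] and a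
    part carried by [c]. *)
Record split_roots (b c : 'I_3 -> 'I_3 -> A) : Prop := SplitRoots {
  sr_eb : forall i j, e i * b i j = b i j;
  sr_be : forall i j, b i j * e j = b i j;
  sr_ec : forall i j, e j * c i j = c i j;
  sr_ce : forall i j, c i j * e i = c i j;
  sr_bb : forall i j k, distinct3 i j k -> b i j * b j k = b i k;
  sr_cc : forall i j k, distinct3 i j k -> c j k * c i j = - c i k;
  sr_cb : forall i j k, distinct3 i j k -> c i j * b i k = 0;
  sr_bc : forall i j k, distinct3 i j k -> b i k * c j k = 0;
  sr_bc0 : forall i j, i != j -> b i j * c i j = 0;
  sr_cb0 : forall i j, i != j -> c i j * b i j = 0;
  sr_full : forall i j, i != j -> e i = b i j * b j i + c j i * c i j }.

Lemma st_split_roots : split_roots b c.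
Proof.
split=> [i j|i j|i j|i j|i j k d|i j k d|i j k d|i j k d|i j ij|i j ij|i j ij];
  rewrite ?rootpE ?rootnE //; try have D := distinct3P d;
  try have P := distinct3_perm d.
- have := congr1 (fun a => e i * a * e k) (st_comm xP d).
  have -> : e i * (x i j * x j k) * e k = (e i * x i j) * (x j k * e k).
    by rewrite !mulrA.
  have -> : e i * (x i k * (x j k * x i j)) * e k =
            (e i * x i k) * (x j k * (x i j * e k)) by rewrite !mulrA.
  rewrite (st_fix xP d).1 !st_el ?st_er ?D // !mulrDl !mulrDr.
  rewrite (odec_0 (i:=i)) ?D // (emul0 (rootpE j k).1) ?D //.
  rewrite (mule0 (rootpE i j).2) ?D // (rootpE i k).2 add0r add0r add0r.
  by rewrite (mule_mul0 (rootpE i k).2 (rootpE j k).1) ?D // addr0 add0r.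
- have := congr1 (fun a => e k * a * e i) (st_comm xP d).
  have -> : e k * (x i j * x j k) * e i = (e k * x i j) * (x j k * e i).
    by rewrite !mulrA.
  have -> : e k * (x i k * (x j k * x i j)) * e i =
            (e k * x i k) * x j k * (x i j * e i) by rewrite !mulrA.
  have [jki ijk] : fixes (x j k) i by apply: (st_fix xP); rewrite P.
  rewrite (st_fix xP d).2 jki st_eln ?st_ern ?D // !mulrDl.
  have -> : c i k * x j k = c i k.
    by rewrite -{1}(rootnE i k).2 -mulrA ijk (rootnE i k).2.
  rewrite st_eln ?D // !mulrDr !mulrDl.
  rewrite (odec_0 (i:=k)) ?D // (mule0 (rootnE j k).2) ?D //.
  rewrite (emul0 (rootnE i j).1) ?D // (rootnE i k).2 !add0r => /eqP.
  rewrite (mule_mul0 (rootnE i k).2 (rootnE i j).1) ?D // addr0 addrC eq_sym.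
  by rewrite addr_eq0 => /eqP ->; rewrite opprK.
- have := congr1 (fun a => e j * a * e k) (st_row xP d).
  have -> : e j * (x i j * x i k) * e k = (e j * x i j) * (x i k * e k).
    by rewrite !mulrA.
  have -> : e j * (x i k * x i j) * e k = (e j * x i k) * (x i j * e k).
    by rewrite !mulrA.
  rewrite (st_fix xP d).1; have [_ ->] : fixes (x i k) j.
    by apply: (st_fix xP); rewrite P.
  rewrite st_eln ?st_er ?D // !mulrDl !mulrDr (odec_0 (i:=j)) ?D // add0r.
  by rewrite (emul0 (rootpE i k).1) ?D // (mule0 (rootnE i j).2) ?D // !add0r.
- have := congr1 (fun a => e i * a * e j) (st_col xP d).
  have -> : e i * (x i k * x j k) * e j = (e i * x i k) * (x j k * e j).
    by rewrite !mulrA.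
  have -> : e i * (x j k * x i k) * e j = (e i * x j k) * (x i k * e j).
    by rewrite !mulrA.
  have [-> _] : fixes (x i k) j by apply: (st_fix xP); rewrite P.
  have [_ ->] : fixes (x j k) i by apply: (st_fix xP); rewrite P.
  rewrite st_el ?st_ern ?D // !mulrDl !mulrDr (odec_0 (i:=i)) ?D // add0r.
  by rewrite (emul0 (rootnE j k).1) ?D // (mule0 (rootpE i k).2) ?D // !add0r.
- exact: (root_sq ij).1.
- exact: (root_sq ij).2.
- have ji : j != i by rewrite eq_sym.
  (* Expanded in the corner of [e i], the Weyl relation reads e_i - b_ij b_ji - c_ji c_ij = 0; every
     other product dies for block reasons or by [root_sq]. *)
  have := st_weyl xP ij; rewrite !mulrA st_el // -[_ * x i j * e i]mulrA st_ern //.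
  rewrite st_unipV //.
  have -> : (e i + b i j) * (1 - b j i - c j i) * (e i + c i j) =
    e i * e i - (b i j * b j i) * e i - (e i * c j i) * c i j +
    (e i * c i j - (e i * b j i) * e i - (e i * b j i) * c i j
      - (e i * c j i) * e i + b i j * e i + b i j * c i j
      - b i j * (b j i * c i j) - b i j * c j i * e i - b i j * c j i * c i j).
    by move: (e i) (b i j) (b j i) (c i j) (c j i) => *; ncring.
  rewrite odec_id -mulrA (rootpE j i).2 (rootnE j i).1.
  rewrite (emul0 (rootnE i j).1) // (emul0 (rootpE j i).1) // !mul0r.
  rewrite (mule0 (rootnE j i).2) // (mule0 (rootpE i j).2) // (root_sq ij).1.
  rewrite (mule_mul0 (rootpE j i).2 (rootnE i j).1) // mulr0.
  rewrite (mule_mul0 (rootpE i j).2 (rootnE j i).1) // !mul0r !subr0 !addr0.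
  by move/eqP; rewrite -addrA -opprD subr_eq0 => /eqP.
Qed.
End Steinberg.

(** * Separating roots from reversed roots *)

Section Mixing.
Variables b c : 'I_3 -> 'I_3 -> A.
Hypothesis bcP : split_roots b c.
Variables i j k : 'I_3.
Hypothesis d : distinct3 i j k.

(* N ranges over the tangent directions at x_ik of the centralizer used to
   define the root subgroup; if such N did not commute with the neighbouring
   roots, b- and c-roots would be mixed. *)
Hypothesis unmixed : forall N, N * N = 0 -> e j * N = 0 -> N * e j = 0 ->
  e i * N * e i = 0 -> e k * N * e k = 0 ->
  N * (b i k + c i k) = (b i k + c i k) * N ->
  N * (b i j + c i j) = (b i j + c i j) * N /\
  N * (b j k + c j k) = (b j k + c j k) * N.

Let D := distinct3P d.
Let P := distinct3_perm d.
Let eb := sr_eb bcP. Let be := sr_be bcP.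
Let ec := sr_ec bcP. Let ce := sr_ce bcP.

Let mm0 a k' l a' : a * e k' = a -> e l * a' = a' -> k' != l -> a * a' = 0.
Proof. exact: mule_mul0. Qed.

Let bkb l m : l != m -> b l m * (b m l * b l m) = b l m.
Proof.
move=> lm; rewrite mulrA -[RHS]eb (sr_full bcP lm) mulrDl.
by rewrite -[c m l * _ * _]mulrA (sr_cb0 bcP) // mulr0 addr0.
Qed.
Let ckc l m : l != m -> c l m * (c m l * c l m) = c l m.
Proof.
move=> lm; rewrite -[RHS]ce [in RHS](sr_full bcP lm) mulrDr.
by rewrite !mulrA (sr_cb0 bcP) // mul0r add0r.
Qed.

(** By [sr_full] the outer factors are complementary idempotents f and g of block i, so this is the
    vanishing of a Peirce component f a g. Such a component gives a tangent direction N to which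
    [unmixed] applies. *)
Lemma unmixed_bc a : (b i k * b k i) * a * (c k i * c i k) = 0.
Proof.
suff H a' : b i k * (b k i * a') = a' -> a' * c k i * c i k = a' -> a' = 0.
  by apply: H; [rewrite !mulrA -[b i k * _ * b i k]mulrA bkb ?D
               |rewrite -!mulrA ckc ?D].
move=> fa ag.
have ea : e i * a' = a' by rewrite -fa mulrA eb.
have ae : a' * e i = a' by rewrite -ag -mulrA ce.
have aa : a' * a' = 0.
  rewrite -{1}ag -fa -!mulrA (mulrA (c i k) (b i k)) (sr_cb0 bcP) ?D //.
  by rewrite mul0r !mulr0.
have abik : a' * b i k = 0 by rewrite -ag -!mulrA (sr_cb0 bcP) ?D // !mulr0.
have abij : a' * b i j = 0 by rewrite -ag -!mulrA (sr_cb bcP) ?P // !mulr0.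
have abki : a' * b k i = 0 by rewrite (mm0 ae (eb k i)) ?D.
have acik : a' * c i k = 0 by rewrite (mm0 ae (ec i k)) ?D.
have cika : c i k * a' = 0 by rewrite -fa mulrA (sr_cb0 bcP) ?D // mul0r.
have bika : b i k * a' = 0 by rewrite (mm0 (be i k) ea) ?D.
have ckia : c k i * a' = 0 by rewrite (mm0 (ce k i) ea) ?D.
have cb : c k i * b k i = 0 by rewrite (sr_cb0 bcP) ?D.
(* The summands are matched: [N * c i k] and [b i k * N] both equal a', which makes N commute with
   [b i k + c i k]. Commutation with the root at (j,k) then gives [a' * c j i = 0], while
   [a' * b i j = 0] already, so [sr_full] for i, j kills a'. *)
pose N := a' * c k i + b k i * a'.
have [||||||_] := unmixed (N := N).
- rewrite /N !mulrDl !mulrDr !mulrA -[_ * c k i * a']mulrA ckia.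
  rewrite -[a' * c k i * b k i]mulrA cb -[b k i * a' * a']mulrA aa.
  by rewrite -[b k i * a' * b k i]mulrA abki !(mulr0, mul0r) !addr0.
- by rewrite /N mulrDr !mulrA (emul0 ea) ?D // (emul0 (eb k i)) ?D // !mul0r addr0.
- by rewrite /N mulrDl -!mulrA (mule0 (ce k i)) ?D // (mule0 ae) ?D // !mulr0 addr0.
- rewrite /N mulrDr mulrDl -!mulrA (mule0 (ce k i)) ?D // !mulr0 add0r.
  by rewrite mulrA (emul0 (eb k i)) ?D // mul0r.
- rewrite /N mulrDr mulrDl !mulrA (emul0 ea) ?D // !mul0r add0r.
  by rewrite -!mulrA (mule0 ae) ?D // !mulr0.
- rewrite /N !mulrDl !mulrDr !mulrA ag bika cika -[c i k * b k i * a']mulrA.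
  rewrite -[a' * c k i * b i k]mulrA (mm0 (ce k i) (eb i k)) ?D //.
  rewrite -[b k i * a' * b i k]mulrA abik -[b k i * a' * c i k]mulrA acik.
  rewrite [c i k * (_ * _)]mulrA (mm0 (ce i k) (eb k i)) ?D //.
  by rewrite -[b i k * _ * _]mulrA fa !(mulr0, mul0r) !(addr0, add0r).
move/(congr1 (fun u => e i * u * e j)).
have -> : e i * (N * (b j k + c j k)) * e j = a' * (c k i * c j k).
  rewrite /N !mulrDl !mulrDr !mulrDl !mulrA ea (emul0 (eb k i)) ?D // !mul0r !addr0.
  rewrite -!mulrA (mule0 (be j k)) ?D // ce !mulr0 add0r.
  by [].
have -> : e i * ((b j k + c j k) * N) * e j = 0.
  have z : e i * (b j k + c j k) = 0.
    by rewrite mulrDr (emul0 (eb j k)) ?D // (emul0 (ec j k)) ?D // addr0.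
  by rewrite [e i * (_ * _)]mulrA z !mul0r.
rewrite (sr_cc bcP) ?P // mulrN => /eqP; rewrite oppr_eq0 => /eqP acji.
rewrite -ae (sr_full bcP (i := i) (j := j)) ?D // mulrDr !mulrA abij acji.
by rewrite !mul0r addr0.
Qed.

Lemma unmixed_cb a : (c k i * c i k) * a * (b i k * b k i) = 0.
Proof.
suff H a' : c k i * (c i k * a') = a' -> a' * b i k * b k i = a' -> a' = 0.
  by apply: H; [rewrite !mulrA -[c k i * _ * c k i]mulrA ckc ?D
               |rewrite -!mulrA bkb ?D].
move=> ga af.
have ea : e i * a' = a' by rewrite -ga mulrA ec.
have ae : a' * e i = a' by rewrite -af -mulrA be.
have aa : a' * a' = 0.
  rewrite -{1}af -ga -!mulrA (mulrA (b k i) (c k i)) (sr_bc0 bcP) ?D //.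
  by rewrite mul0r !mulr0.
have acik : a' * c i k = 0 by rewrite (mm0 ae (ec i k)) ?D.
have acji : a' * c j i = 0 by rewrite -af -!mulrA (sr_bc bcP) ?P // !mulr0.
have cika0 : b i k * a' = 0 by rewrite (mm0 (be i k) ea) ?D.
have bc : b i k * c i k = 0 by rewrite (sr_bc0 bcP) ?D.
have cb : c i k * b i k = 0 by rewrite (sr_cb0 bcP) ?D.
(* Here both sides of the commutation with [b i k + c i k] reduce to [c i k * a' * b i k], and it is
   the root at (i,j) that yields [a' * b i j = 0]. *)
pose N := c i k * a' + a' * b i k.
have [||||||+ _] := unmixed (N := N).
- rewrite /N !mulrDl !mulrDr !mulrA -[c i k * a' * c i k]mulrA acik.
  rewrite -[c i k * a' * a']mulrA aa.
  rewrite -[a' * b i k * c i k]mulrA bc -[a' * b i k * a']mulrA cika0.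
  by rewrite !(mulr0, mul0r) !addr0.
- by rewrite /N mulrDr !mulrA (emul0 (ec i k)) ?D // (emul0 ea) ?D // !mul0r addr0.
- by rewrite /N mulrDl -!mulrA (mule0 ae) ?D // (mule0 (be i k)) ?D // !mulr0 addr0.
- rewrite /N mulrDr mulrDl !mulrA (emul0 (ec i k)) ?D // !mul0r add0r.
  by rewrite -!mulrA (mule0 (be i k)) ?D // !mulr0.
- rewrite /N mulrDr mulrDl -!mulrA (mule0 ae) ?D // !mulr0 add0r.
  by rewrite mulrA (emul0 ea) ?D // mul0r.
- rewrite /N !mulrDl !mulrDr !mulrA -[c i k * a' * c i k]mulrA acik.
  rewrite -[a' * b i k * c i k]mulrA bc.
  rewrite -[a' * b i k * b i k]mulrA (mm0 (be i k) (eb i k)) ?D //.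
  rewrite cika0 (mm0 (ce i k) (ec i k)) ?D //.
  by rewrite !(mulr0, mul0r) !(addr0, add0r).
move/(congr1 (fun u => e k * u * e j)).
have -> : e k * (N * (b i j + c i j)) * e j = c i k * (a' * b i j).
  rewrite /N !mulrDl !mulrDr !mulrDl !mulrA ec (emul0 ea) ?D // !mul0r !addr0.
  by rewrite -!mulrA (mule0 (ce i j)) ?D // be !mulr0 addr0.
have -> : e k * ((b i j + c i j) * N) * e j = 0.
  have z : e k * (b i j + c i j) = 0.
    by rewrite mulrDr (emul0 (eb i j)) ?D // (emul0 (ec i j)) ?D // addr0.
  by rewrite [e k * (_ * _)]mulrA z !mul0r.
move/(congr1 (fun u => c k i * u)); rewrite mulr0 => H.
have abij : a' * b i j = 0 by rewrite -ga -!mulrA.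
rewrite -ae (sr_full bcP (i := i) (j := j)) ?D // mulrDr !mulrA abij acji.
by rewrite !mul0r addr0.
Qed.

(** The [b]-parts and the [c]-parts of the blocks add up to F and G with F + G = 1. The parts of
    every block factor through those of block i, so the two preceding lemmas give F A G = G A F = 0.
    Thus F is a central idempotent. *)
Lemma root_dichotomy : no_nontrivial_central_idempotent A ->
  (forall l m, l != m -> c l m = 0) \/ (forall l m, l != m -> b l m = 0).
Proof.
move=> connA.
(* The idempotent that [b] cuts out of block l does not depend on the second index, because [b l n]
   and [b n l] factor through block m. *)
have indep l m n : distinct3 l m n -> b l n * b n l = b l m * b m l.
  move=> q; have Q := distinct3P q; have R := distinct3_perm q.
  rewrite -(sr_bb bcP q) -(sr_bb bcP (i:=n) (j:=m) (k:=l)) ?R //.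
  rewrite mulrA -(mulrA (b l m)).
  have -> : b m n * b n m = e m - c n m * c m n.
    by rewrite {1}(sr_full bcP (i:=m) (j:=n)) ?Q // addrK.
  rewrite mulrBr mulrA (sr_bc bcP) ?R // mul0r subr0 be.
  by [].
have indep' l m n : distinct3 l m n -> c n l * c l n = c m l * c l m.
  move=> q; have Q := distinct3P q; apply: (addrI (b l m * b m l)).
  by rewrite -{1}(indep _ _ _ q) -!(sr_full bcP) ?Q.
pose f (l : 'I_3) := if l == i then b i k * b k i else b l i * b i l.
pose g (l : 'I_3) := if l == i then c k i * c i k else c i l * c l i.
have fE (l m : 'I_3) : l != m -> b l m * b m l = f l.
  rewrite /f; have [->|li] := eqVneq l i => lm.
    have [->//|mk] := eqVneq m k.
    by rewrite -(indep i m k) // /distinct3 D lm mk.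
  have [->//|mi] := eqVneq m i.
  by rewrite (indep l i m) // /distinct3 li lm eq_sym.
have gE (l m : 'I_3) : l != m -> c m l * c l m = g l.
  rewrite /g; have [->|li] := eqVneq l i => lm.
    have [->//|mk] := eqVneq m k.
    by rewrite -(indep' i m k) // /distinct3 D lm mk.
  have [->//|mi] := eqVneq m i.
  by rewrite (indep' l i m) // /distinct3 li lm eq_sym.
have other (l : 'I_3) : exists m, l != m.
  by have [->|] := eqVneq l i; [exists j; rewrite D | exists i].
have fg l : f l + g l = e l.
  by have [m lm] := other l; rewrite -(fE l m) // -(gE l m) // -(sr_full bcP).
have fi l : exists u v, f l = u * f i * v.
  have [->|li] := eqVneq l i; first by exists 1, 1; rewrite mul1r mulr1.
  exists (b l i), (b i l); rewrite -(fE l i) // -(fE i l) 1?eq_sym //.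
  by rewrite bkb.
have gi l : exists u v, g l = u * g i * v.
  have [->|li] := eqVneq l i; first by exists 1, 1; rewrite mul1r mulr1.
  exists (c i l), (c l i); rewrite -(gE l i) // -(gE i l) 1?eq_sym //.
  by rewrite ckc // eq_sym.
have fag a l m : f l * a * g m = 0.
  have [u [v ->]] := fi l; have [u' [v' ->]] := gi m.
  have -> : u * f i * v * a * (u' * g i * v') = u * (f i * (v * a * u') * g i) * v'.
    by rewrite !mulrA.
  by rewrite /f /g eqxx unmixed_bc mulr0 mul0r.
have gaf a l m : g l * a * f m = 0.
  have [u [v ->]] := gi l; have [u' [v' ->]] := fi m.
  have -> : u * g i * v * a * (u' * f i * v') = u * (g i * (v * a * u') * f i) * v'.
    by rewrite !mulrA.
  by rewrite /f /g eqxx unmixed_cb mulr0 mul0r.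
pose F := \sum_l f l; pose G := \sum_l g l.
have FG1 : F + G = 1.
  by rewrite /F /G -big_split -[RHS]eP.2; apply: eq_bigr => l _; exact: fg.
have FaG a : F * a * G = 0.
  by rewrite !mulr_suml big1 // => l _; rewrite mulr_sumr big1.
have GaF a : G * a * F = 0.
  by rewrite !mulr_suml big1 // => l _; rewrite mulr_sumr big1.
have FF : F * F = F.
  have FG0 : F * G = 0 by rewrite -[F]mulr1 FaG.
  by rewrite -[RHS]mulr1 -FG1 mulrDr FG0 addr0.
have cF a : GRing.comm F a.
  rewrite /GRing.comm -[LHS]mulr1 -[RHS]mul1r -FG1 mulrDr mulrDl FaG.
  by rewrite [G * (_ * _)]mulrA GaF !addr0 mulrA.
have ef (l m : 'I_3) : l != m -> e l * f m = 0.
  move=> lm; have [n mn] := other m; rewrite -(fE m n) //.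
  by rewrite mulrA (emul0 (eb m n)) ?mul0r // eq_sym.
have eg (l m : 'I_3) : l != m -> e l * g m = 0.
  move=> lm; have [n mn] := other m; rewrite -(gE m n) //.
  by rewrite mulrA (emul0 (ec n m)) ?mul0r // eq_sym.
have [F0|F1] := connA F FF cF; [right|left] => l m lm.
  have fl0 : f l = 0.
    rewrite -(fE l m) // -eb -mulrA fE //.
    have := congr1 (fun a => e l * a) F0; rewrite mulr0 mulr_sumr.
    by rewrite (bigD1 l) //= big1 ?addr0 // => n nl; rewrite ef // eq_sym.
  by rewrite -bkb // mulrA fE // fl0 mul0r.
have G0 : G = 0 by apply: (addrI F); rewrite FG1 addr0.
have gl0 : g l = 0.
  rewrite -(gE l m) // -ec -mulrA gE //.
  have := congr1 (fun a => e l * a) G0; rewrite mulr0 mulr_sumr.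
  by rewrite (bigD1 l) //= big1 ?addr0 // => n nl; rewrite eg // eq_sym.
by rewrite -ckc // gE // gl0 mulr0.
Qed.
End Mixing.
End Blocks.

(** * Coding a ring in its unit group *)

Definition commutator (G : groupType) (g h : G) : G := (g * h * (h * g)^-1)%g.

Definition unit_embedding (G : groupType) (A : pzRingType) (iota : G -> A) :=
  [/\ iota 1%g = 1, forall g h, iota (g * h)%g = iota g * iota h,
      injective iota &
      forall a b, a * b = 1 -> b * a = 1 -> exists g, iota g = a].

(* [code] is a bijection of B with the root subgroup of x02, which is defined by
   means of eps1 and eps2; 0, 1 and the operations of B become group words. *)
Definition coding (G : groupType) (x02 x21 x10 eps1 eps2 : G)
    (B : pzRingType) (code : B -> G) : Prop :=
  injective code /\
  (forall g, (exists a, code a = g) <->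
     exists h, [/\ (h * x02 = x02 * h)%g, (h * eps1 = eps1 * h)%g &
                   (g = h * eps2 * h^-1 * eps2)%g]) /\
  [/\ code 0 = 1%g, code 1 = x02, (forall a, code (- a) = (code a)^-1)%g,
      (forall a b, code (a + b) = code a * code b)%g &
      forall a b, code (a * b) =
        commutator (commutator (code a) x21) (commutator x10 (code b))].

Definition o0 : 'I_3 := @Ordinal 3 0 isT.
Definition o1 : 'I_3 := @Ordinal 3 1 isT.
Definition o2 : 'I_3 := @Ordinal 3 2 isT.

Lemma ord3P (i : 'I_3) : [\/ i = o0, i = o1 | i = o2].
Proof.
by case: i => [[|[|[|//]]] ?]; [constructor 1|constructor 2|constructor 3];
  apply: val_inj.
Qed.

Lemma d012 : distinct3 o0 o1 o2. Proof. by []. Qed.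

Section Half.
Variable A : pzRingType.
Hypothesis halfA : contains_half A.

Lemma halfP : exists h : A, h + h = 1 /\ forall a, h * a = a * h.
Proof.
have [h [h2 h2']] := halfA; exists h; split.
  by rewrite -h2 mulr2n mulrDr mulr1.
move=> a; rewrite -[LHS]mulr1 -h2' mulrA -[h * a * _]mulrA.
by rewrite [a * 2%:R]mulr_natr -mulr_natl mulrA h2 mul1r.
Qed.

Lemma addrr_inj (a b : A) : a + a = b + b -> a = b.
Proof.
have [h [hh _]] := halfP => H.
by rewrite -[a]mul1r -[b]mul1r -hh !mulrDl -!mulrDr H.
Qed.
End Half.

Section UnitEmbedding.
Variables (G : groupType) (A : pzRingType) (iota : G -> A).
Hypothesis iotaP : unit_embedding iota.

Lemma ue1 : iota 1%g = 1. Proof. by case: iotaP. Qed.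
Lemma ueM g h : iota (g * h)%g = iota g * iota h. Proof. by case: iotaP. Qed.
Lemma ue_inj : injective iota. Proof. by case: iotaP. Qed.
Lemma ue_surj a b : a * b = 1 -> b * a = 1 -> exists g, iota g = a.
Proof. by case: iotaP => _ _ _; apply. Qed.
Lemma ueV g : iota g * iota g^-1%g = 1.
Proof. by rewrite -ueM mulgV ue1. Qed.
Lemma ueVl g : iota g^-1%g * iota g = 1.
Proof. by rewrite -ueM mulVg ue1. Qed.
Lemma ueV_uniq g a : iota g * a = 1 -> iota g^-1%g = a.
Proof. by move=> ga; rewrite -[LHS]mulr1 -ga mulrA ueVl mul1r. Qed.

Lemma ue_unip (n : A) : n * n = 0 -> exists g, iota g = 1 + n.
Proof.
move=> nn; apply: (@ue_surj _ (1 - n)).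
  by transitivity (1 - n * n); [ncring | rewrite nn subr0].
by transitivity (1 - n * n); [ncring | rewrite nn subr0].
Qed.

Lemma ue_commutator g h n m : iota g = 1 + n -> iota h = 1 + m ->
  m * n = 0 -> m * m = 0 -> iota (commutator g h) = 1 + n * m.
Proof.
move=> gn hm mn mm; rewrite /commutator ueM.
have -> : iota (g * h)%g = (1 + n * m) * iota (h * g)%g.
  rewrite !ueM gn hm.
  transitivity (1 + n + m + n * m + m * n + n * (m * m) + n * (m * n)
    + n * (m * (m * n))); last by ncring.
  by rewrite mn mm !mulr0 !addr0; ncring.
by rewrite -mulrA ueV mulr1.
Qed.
End UnitEmbedding.

Section Coding.
Variables (A : pzRingType) (e : 'I_3 -> A).
Hypothesis halfA : contains_half A.
Hypothesis eP : orthogonal_decomposition e.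

Record matrix_units (b : 'I_3 -> 'I_3 -> A) : Prop := MatrixUnits {
  mu_eb : forall i j, e i * b i j = b i j;
  mu_be : forall i j, b i j * e j = b i j;
  mu_bb : forall i j k, distinct3 i j k -> b i j * b j k = b i k;
  mu_bv : forall i j, i != j -> b i j * b j i = e i }.

Variable b : 'I_3 -> 'I_3 -> A.
Hypothesis bP : matrix_units b.
Let eb := mu_eb bP. Let be := mu_be bP.
Local Notation r := (refl e).

Lemma refl_comm i u : u * r i = r i * u -> u * e i = e i * u.
Proof.
rewrite /refl !mulrBr !mulrBl mulr1 mul1r -!addrA => /addrI.
by rewrite -!opprD => /oppr_inj/(addrr_inj halfA).
Qed.

Lemma refl_sq i : r i * r i = 1.
Proof.
have id := odec_id eP i.
transitivity (1 + (e i * e i - e i) + (e i * e i - e i) + (e i * e i - e i)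
  + (e i * e i - e i)); first by rewrite /refl; ncring.
by rewrite id subrr !addr0.
Qed.

Lemma centralizer_root_zero u : u * (1 + b o0 o2) = (1 + b o0 o2) * u ->
  u * r o1 = r o1 * u ->
  [/\ u * b o0 o2 = b o0 o2 * u, e o2 * u * e o0 = 0,
      e o2 * u * e o1 = 0 & e o1 * u * e o2 = 0].
Proof.
rewrite mulrDr mulrDl mulr1 mul1r => /addrI ub /refl_comm ue; split=> //.
- rewrite -(mu_bv bP (i:=o0) (j:=o2)) // mulrA -(mulrA (e o2)) ub mulrA.
  by rewrite (emul0 eP (eb _ _)) // !mul0r.
- by rewrite -mulrA ue mulrA odec_0 // mul0r.
- by rewrite -ue -mulrA odec_0 // mulr0.
Qed.

(** Centralizing x_02 and the reflection in block 1 leaves u a single off-diagonal entry, at (0,2).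
    In its commutator with the reflection in block 2 the diagonal cancels and that entry is
    doubled. *)
Lemma root_subgroup_shape u u' : u * u' = 1 -> u' * u = 1 ->
  u * (1 + b o0 o2) = (1 + b o0 o2) * u -> u * r o1 = r o1 * u ->
  exists2 n, u * r o2 * u' * r o2 = 1 + n & e o0 * n * e o2 = n.
Proof.
move=> uu' u'u ub ue.
have flip v : u * v = v * u -> u' * v = v * u'.
  by move=> uv; rewrite -[v * u']mul1r -u'u -!mulrA (mulrA u) uv -mulrA uu' mulr1.
have [_ u20 u21 u12] := centralizer_root_zero ub ue.
have [_ v20 v21 _] := centralizer_root_zero (flip _ ub) (flip _ ue).
have e1 : e o0 + e o1 + e o2 = 1 by rewrite (distinct3_sum e d012) eP.2.
have eu : e o2 * u = e o2 * u * e o2.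
  by rewrite -[LHS]mulr1 -e1 !mulrDr u20 u21 !add0r.
have eu' : e o2 * u' = e o2 * u' * e o2.
  by rewrite -[LHS]mulr1 -e1 !mulrDr v20 v21 !add0r.
have ue' : u * e o2 = e o0 * u * e o2 + e o2 * u * e o2.
  rewrite -[LHS]mul1r -e1 !mulrDl !mulrA u12 addr0.
  by [].
pose w := e o0 * u * e o2 * u' * e o2; exists (w + w).
  have H : u * r o2 = r o2 * u - (e o0 * u * e o2 + e o0 * u * e o2).
    rewrite /refl !mulrBr !mulrBl mulr1 mul1r eu ue'.
    by move: (e o0 * u * e o2) (e o2 * u * e o2) => *; ncring.
  have K : e o2 * u' * r o2 = - (e o2 * u' * e o2).
    by rewrite {1}eu' -mulrA refl_mull_id // mulrN.
  have -> : u * r o2 * u' * r o2 = r o2 * (u * u') * r o2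
    - e o0 * u * (e o2 * u' * r o2) - e o0 * u * (e o2 * u' * r o2).
    by rewrite H; move: (r o2) (e o0) (e o2) => *; ncring.
  rewrite uu' mulr1 refl_sq K /w.
  by move: (e o0) (e o2) => *; ncring.
rewrite mulrDr mulrDl /w !mulrA odec_id // -!mulrA odec_id //.
Qed.

Variables (Q Q' : A).
Hypotheses (QV : Q * Q' = 1) (QVl : Q' * Q = 1).
Hypothesis Qe : Q * e o0 = (1 - e o0) * Q.

(* Q maps the image of e_0 onto the complementary one, which is a sum of two
   copies of the image of e_0; hence the corner e_0 A e_0 is isomorphic to A. *)
Lemma corner_iso : exists s t, [/\ t * s = 1, s * t = e o0, e o0 * s = s & t * e o0 = t].
Proof.
have c12 : 1 - e o0 = e o1 + e o2.
  by rewrite -eP.2 -(distinct3_sum e d012) -[e o0 + _ + _]addrA addrC addrK.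
have Q'e : e o0 * Q' = Q' * (1 - e o0).
  transitivity (Q' * (Q * e o0) * Q'); first by rewrite mulrA QVl mul1r.
  by rewrite Qe -!mulrA QV mulr1.
pose z := b o1 o0 * e o0 + b o2 o0 * Q' * (1 - e o0).
pose y := b o0 o1 + Q * b o0 o2.
have cz : (1 - e o0) * z = z.
  have ez : e o0 * z = 0.
    rewrite /z mulrDr !mulrA (emul0 eP (eb o1 o0)) //.
    by rewrite (emul0 eP (eb o2 o0)) // !mul0r addr0.
  by rewrite mulrBl mul1r ez subr0.
exists (Q' * z), (y * Q * e o0); split.
- have -> : y * Q * e o0 * (Q' * z) = y * z.
    rewrite -(mulrA y) Qe -!mulrA (mulrA Q) QV mul1r cz.
    by [].
  have y1 : b o0 o1 * z = e o0.
    rewrite /z mulrDr !mulrA mu_bv // odec_id //.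
    by rewrite (mule_mul0 eP (be o0 o1) (eb o2 o0)) // !mul0r addr0.
  have y2 : b o0 o2 * z = Q' * (1 - e o0).
    rewrite /z mulrDr !mulrA (mule_mul0 eP (be o0 o2) (eb o1 o0)) // mul0r add0r.
    by rewrite mu_bv // Q'e -mulrA mulrBr mulr1 mulrBl mul1r odec_id // subrr subr0.
  by rewrite /y mulrDl y1 -mulrA y2 mulrA QV mul1r addrC subrK.
- have -> : Q' * z * (y * Q * e o0) = Q' * (z * y) * (Q * e o0) by rewrite !mulrA.
  have -> : z * y = 1 - e o0.
    have z1 : z * b o0 o1 = e o1.
      rewrite /z mulrDl -!mulrA mulrBl mul1r eb subrr !mulr0 addr0.
      by rewrite mu_bv.
    have z2 : z * (Q * b o0 o2) = e o2.
      rewrite /z mulrDl -(mulrA (b o1 o0)).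
      have -> : e o0 * (Q * b o0 o2) = 0.
        by rewrite -eb (mulrA Q) Qe !mulrA mulrBr mulr1 odec_id // subrr !mul0r.
      rewrite mulr0 add0r -!mulrA (mulrA _ Q) -Qe -!mulrA eb (mulrA Q') QVl mul1r.
      by rewrite mu_bv.
    by rewrite /y mulrDr z1 z2 c12.
  have -> : Q' * (1 - e o0) * (Q * e o0) = Q' * ((1 - e o0) * Q) * e o0.
    by rewrite !mulrA.
  by rewrite -Qe mulrA QVl mul1r odec_id.
- by rewrite mulrA Q'e -mulrA cz.
- by rewrite -mulrA odec_id.
Qed.

Variables (G : groupType) (iota : G -> A).
Hypothesis iotaP : unit_embedding iota.
Variables (x02 x21 x10 eps1 eps2 : G).
Hypotheses (x02E : iota x02 = 1 + b o0 o2) (x21E : iota x21 = 1 + b o2 o1).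
Hypotheses (x10E : iota x10 = 1 + b o1 o0).
Hypotheses (eps1E : iota eps1 = r o1) (eps2E : iota eps2 = r o2).

Lemma coding_exists : exists code : A -> G, coding x02 x21 x10 eps1 eps2 code.
Proof.
have [s [t [ts st es te]]] := corner_iso.
have bs l : l != o0 -> forall i, b i l * s = 0.
  by move=> l0 i; rewrite (mule_mul0 eP (be i l) es).
(* The corner isomorphism puts a at position (0,0), and [b o0 o2] moves it to (0,2). *)
pose mu a := s * a * t * b o0 o2.
have emu a : e o0 * mu a = mu a by rewrite /mu !mulrA es.
have mue a : mu a * e o2 = mu a by rewrite /mu -mulrA be.
have mumu a a' : mu a * mu a' = 0 by rewrite (mule_mul0 eP (mue a) (emu a')).
have /choice[code codeE] : forall a, exists g, iota g = 1 + mu a.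
  by move=> a; exact: (ue_unip iotaP (mumu a a)).
have mu_inj : injective mu.
  move=> a a' /(congr1 (fun u => t * (u * b o2 o0) * s)).
  have H u : t * (mu u * b o2 o0) * s = u.
    rewrite /mu -mulrA -[_ * b o0 o2 * _]mulrA mu_bv // -!mulrA es ts mulr1.
    by rewrite mulrA ts mul1r.
  by rewrite !H.
have inj := ue_inj iotaP.
exists code; split; [|split].
- by move=> a a' /(congr1 iota); rewrite !codeE => /addrI/mu_inj.
- move=> g; split=> [[a <-]|[h [hx he ->]]].
    have [c [cc cC]] := halfP halfA.
    (* The flip by eps_2 doubles the entry, so the witness for a carries a/2. *)
    have [h hE] := ue_unip iotaP (mumu (c * a) (c * a)).
    have h'E : iota h^-1%g = 1 - mu (c * a).
      apply: (ueV_uniq iotaP); rewrite hE.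
      transitivity (1 - mu (c * a) * mu (c * a)); first by ncring.
      by rewrite mumu subr0.
    have m2 : mu (c * a) * e o1 = 0 by rewrite (mule0 eP (mue _)).
    have m3 : e o1 * mu (c * a) = 0 by rewrite (emul0 eP (emu _)).
    exists h; split; apply: inj; rewrite !(ueM iotaP).
    + rewrite hE x02E !mulrDr !mulrDl !mulr1 !mul1r.
      rewrite (mule_mul0 eP (mue _) (eb o0 o2)) //.
      by rewrite (mule_mul0 eP (be o0 o2) (emu _)) // !addr0 addrAC.
    + have mr : mu (c * a) * r o1 = mu (c * a).
        by rewrite /refl !mulrBr m2 mulr1 !subr0.
      have rm : r o1 * mu (c * a) = mu (c * a).
        by rewrite /refl !mulrBl m3 mul1r !subr0.
      by rewrite hE eps1E [LHS]mulrDl [RHS]mulrDr mr rm mul1r mulr1.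
    + rewrite codeE hE h'E eps2E.
      have H : r o2 * mu (c * a) * r o2 = - mu (c * a).
        rewrite -emu (mulrA (r o2)) refl_mulr_0 // emu -(mue (c * a)).
        by rewrite -mulrA refl_mull_id // mulrN mue.
      have -> : (1 + mu (c * a)) * r o2 * (1 - mu (c * a)) * r o2 =
         (1 + mu (c * a)) * (r o2 * r o2 - r o2 * mu (c * a) * r o2).
        by move: (r o2) (mu _) => *; ncring.
      rewrite H refl_sq // opprK.
      have muD : mu (c * a) + mu (c * a) = mu a.
        by rewrite /mu -(mulrDl _ _ (b o0 o2)) -(mulrDl _ _ t) -mulrDr -mulrDl cc mul1r.
      rewrite -muD.
      transitivity (1 + mu (c * a) + mu (c * a) + mu (c * a) * mu (c * a)).
        by rewrite mumu addr0 addrA.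
      by ncring.
  have hx' := congr1 iota hx; have he' := congr1 iota he.
  rewrite !(ueM iotaP) x02E in hx'; rewrite !(ueM iotaP) eps1E in he'.
  have [n dn en] := root_subgroup_shape (ueV iotaP h) (ueVl iotaP h) hx' he'.
  exists (t * (n * b o2 o0) * s); apply: inj; rewrite codeE !(ueM iotaP) eps2E dn.
  congr (1 + _); rewrite /mu.
  have -> : s * (t * (n * b o2 o0) * s) * t * b o0 o2 =
            (s * t) * n * (b o2 o0 * (s * t) * b o0 o2) by rewrite !mulrA.
  by rewrite st be mu_bv.
split.
- apply: inj; rewrite codeE (ue1 iotaP) /mu mulr0 !mul0r addr0 //.
- apply: inj; rewrite codeE x02E /mu mulr1 st eb //.
- move=> a; apply: inj; rewrite codeE; symmetry; apply: (ueV_uniq iotaP).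
  rewrite codeE /mu mulrN !mulNr -/(mu a).
  transitivity (1 - mu a * mu a); first by ncring.
  by rewrite mumu subr0.
- move=> a a'; apply: inj; rewrite (ueM iotaP) !codeE.
  transitivity (1 + mu a + mu a' + mu a * mu a'); last by ncring.
  by rewrite mumu addr0 /mu mulrDr !mulrDl addrA.
move=> a a'; apply: inj; rewrite codeE.
(* The commutators with x_21 and x_10 move the two entries to positions (0,1) and (1,2); their
   commutator is the product at (0,2), where [t * s = 1] joins a and a'. *)
have E1 := ue_commutator iotaP (codeE a) x21E.
have E2 := ue_commutator iotaP x10E (codeE a').
rewrite (ue_commutator iotaP (E1 _ _) (E2 _ _)).
- congr (1 + _); rewrite /mu.
  have -> : s * a * t * b o0 o2 * b o2 o1 * (b o1 o0 * (s * a' * t * b o0 o2)) =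
    s * a * t * ((b o0 o2 * b o2 o1) * b o1 o0) * s * a' * t * b o0 o2.
    by rewrite !mulrA.
  by rewrite (mu_bb bP) // mu_bv // -(mulrA (s * a) t) te
    -(mulrA (s * a) t) ts mulr1 mulrA.
- by rewrite /mu !mulrA bs // !mul0r.
- by rewrite (mule_mul0 eP (be o2 o1) (eb o2 o1)).
- by rewrite (mule_mul0 eP (mue a') (eb o1 o0)).
- exact: mumu.
- have -> : b o1 o0 * mu a' * (mu a * b o2 o1) = b o1 o0 * (mu a' * mu a) * b o2 o1.
    by rewrite !mulrA.
  by rewrite mumu mulr0 mul0r.
- have -> : b o1 o0 * mu a' * (b o1 o0 * mu a') = b o1 o0 * (mu a' * b o1 o0) * mu a'.
    by rewrite !mulrA.
  by rewrite (mule_mul0 eP (mue a') (eb o1 o0)) // mulr0 mul0r.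
Qed.

End Coding.

Section Good.
Variable G : groupType.
Variables (m p q : G) (eps : 'I_3 -> G) (y : 'I_3 -> 'I_3 -> G).
Local Open Scope group_scope.

Definition sqy i j : G := y i j * y i j.
Local Notation x := sqy.

(* The intended values are m = -1, eps_i = 1 - 2 e_i, y_ij = 1 + e_ij / 2, p a
   cyclic permutation of the blocks and q an involution exchanging e_0 and
   1 - e_0. [gd_c] forces e_0 e_1 = 0, [gd_q] makes the corner e_0 A e_0
   isomorphic to A, the square roots y_ij force x_ij e_k = e_k, and
   [gd_mix] prevents x_ij from mixing a root with a reversed one. *)
Record good : Prop := Good {
  gd_mC : forall g, g * m = m * g;
  gd_mm : m * m = 1;
  gd_m1 : m <> 1;
  gd_ee : forall i, eps i * eps i = 1;
  gd_eC : forall i j, eps i * eps j = eps j * eps i;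
  gd_eee : eps o0 * eps o1 * eps o2 = m;
  gd_em : eps o0 <> m;
  gd_p0 : p * eps o0 = eps o1 * p;
  gd_p1 : p * eps o1 = eps o2 * p;
  gd_c : forall g, g * g = 1 -> g * p = p * g ->
    (forall h, h * eps o0 = eps o0 * h -> h * eps o1 = eps o1 * h ->
       h * g = g * h) -> g = 1 \/ g = m;
  gd_q : q * eps o0 = m * eps o0 * q;
  gd_fix : forall i j k, distinct3 i j k -> eps k * y i j = y i j * eps k;
  gd_inv : forall i j, i != j -> eps i * y i j * eps i * y i j = 1;
  gd_st : forall i j k, distinct3 i j k -> x i j * x j k = x i k * (x j k * x i j);
  gd_row : forall i j k, distinct3 i j k -> x i j * x i k = x i k * x i j;
  gd_col : forall i j k, distinct3 i j k -> x i k * x j k = x j k * x i k;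
  gd_weyl : forall i j, i != j ->
    x i j * (x j i)^-1 * x i j * eps i = eps j * (x i j * (x j i)^-1 * x i j);
  gd_mix : forall h, h * x o0 o2 = x o0 o2 * h -> h * eps o1 = eps o1 * h ->
    (h * eps o2 * h^-1 * eps o2) * x o0 o1 = x o0 o1 * (h * eps o2 * h^-1 * eps o2) /\
    (h * eps o2 * h^-1 * eps o2) * x o1 o2 = x o1 o2 * (h * eps o2 * h^-1 * eps o2) }.
End Good.

(** * What the group conditions mean in the ring *)

Section GoodStructure.
Variables (A : pzRingType) (G : groupType) (iota : G -> A).
Hypothesis halfA : contains_half A.
Hypothesis connA : no_nontrivial_central_idempotent A.
Hypothesis iotaP : unit_embedding iota.
Hypothesis centerA : forall c : A, (forall g, iota g * c = c * iota g) ->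
  forall a, GRing.comm c a.

(** The element (1 - m)/2 is a central idempotent, hence 0 or 1, and the value 0 would give m =
    1. *)
Lemma central_involution m : (forall g, (g * m = m * g)%g) -> (m * m = 1)%g ->
  m <> 1%g -> iota m = -1.
Proof.
move=> mC mm m1; have [h [hh hC]] := halfP halfA.
have MM : iota m * iota m = 1 by rewrite -(ueM iotaP) mm (ue1 iotaP).
pose e := h * (1 - iota m).
have ee2 : e + e = 1 - iota m by rewrite -mulrDl hh mul1r.
have eC a : GRing.comm e a.
  have mA : iota m * a = a * iota m by apply: centerA => g; rewrite -!(ueM iotaP) mC.
  rewrite /GRing.comm; have -> : e * a = h * (a * (1 - iota m)).
    by rewrite /e -mulrA [(1 - _) * a]mulrBl [a * (1 - _)]mulrBr mul1r mA mulr1.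
  by rewrite /e mulrA hC -mulrA.
have ee : e * e = e.
  apply: (addrr_inj halfA); rewrite -mulrDr ee2 /e -mulrA.
  have -> : (1 - iota m) * (1 - iota m) = (1 - iota m) + (1 - iota m).
    transitivity (1 - iota m - iota m + iota m * iota m); first by ncring.
    by rewrite MM; ncring.
  by rewrite mulrDr -mulrDl hh mul1r.
have [e0|e1] := connA ee eC.
  case: m1; apply: (ue_inj iotaP); apply/eqP; rewrite eq_sym -subr_eq0 (ue1 iotaP).
  by rewrite -ee2 e0 addr0.
by move: ee2; rewrite e1 => /addrI ->; rewrite opprK.
Qed.

Section Fixed.
Variables (m p q : G) (eps : 'I_3 -> G) (y : 'I_3 -> 'I_3 -> G).
Hypothesis gd : good m p q eps y.
Variable h : A.
Hypotheses (hh : h + h = 1) (hC : forall a, h * a = a * h).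
Local Notation E i := (iota (eps i)).
Local Notation x := (sqy y).
Let M := ueM iotaP.

Lemma iota_m : iota m = -1.
Proof. exact: central_involution (gd_mC gd) (gd_mm gd) (gd_m1 gd). Qed.

Definition geps i := h * (1 - E i).
Local Notation e := geps.

Lemma geps_double i : e i + e i = 1 - E i.
Proof. by rewrite -mulrDl hh mul1r. Qed.

Lemma geps_refl i : refl e i = E i.
Proof. by rewrite /refl -addrA -opprD geps_double opprB addrC subrK. Qed.

Lemma EE i : E i * E i = 1.
Proof. by rewrite -M (gd_ee gd) (ue1 iotaP). Qed.

Lemma geps_comm i a : a * E i = E i * a -> a * e i = e i * a.
Proof.
by move=> aE; rewrite /geps mulrA -hC -!mulrA [a * (1 - _)]mulrBr
  [(1 - _) * a]mulrBl mulr1 mul1r aE.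
Qed.

Lemma geps_move i j a : a * E i = E j * a -> a * e i = e j * a.
Proof.
by move=> aE; rewrite /geps mulrA -hC -!mulrA [a * (1 - _)]mulrBr
  [(1 - _) * a]mulrBl mulr1 mul1r aE.
Qed.

Lemma EeC i j : E i * e j = e j * E i.
Proof. by apply: geps_comm; rewrite -!M (gd_eC gd). Qed.

Lemma geps_C i j : e i * e j = e j * e i.
Proof. by apply: geps_comm; rewrite EeC. Qed.

Lemma geps_E i : e i * E i = - e i.
Proof. by rewrite /geps -mulrA mulrBl mul1r EE -mulrN opprB. Qed.

Lemma geps_id i : e i * e i = e i.
Proof.
apply: (addrr_inj halfA); rewrite -mulrDr {1}geps_double mulrBr mulr1 geps_E.
by rewrite opprK.
Qed.

Lemma E_prod i j k : distinct3 i j k -> E k = - (E i * E j).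
Proof.
have H : E o0 * E o1 * E o2 = -1 by rewrite -!M (gd_eee gd) iota_m.
have C u v : E u * E v = E v * E u by rewrite -!M (gd_eC gd).
have e2 : E o2 = - (E o0 * E o1).
  rewrite -[LHS]mul1r -[1]opprK -H mulNr -mulrA EE mulr1 //.
have e1 : E o1 = - (E o0 * E o2).
  by rewrite e2 mulrN opprK mulrA EE mul1r.
have e0 : E o0 = - (E o1 * E o2).
  by rewrite e2 mulrN opprK mulrA (C o1 o0) -mulrA EE mulr1.
by case: (ord3P i) (ord3P j) (ord3P k) => -> [] -> [] -> // _; rewrite // C.
Qed.

(** Substituting eps_k = - eps_i eps_j in e_j (1 - eps_k)/2 and using e_j eps_j = - e_j gives e_j (1
    - eps_i)/2. So the three pairwise products are one and the same idempotent. *)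
Lemma geps_prod_shift i j k : distinct3 i j k -> e j * e k = e i * e j.
Proof.
move=> d; have H l l' : e l * e l' = h * (e l - e l * E l').
  by rewrite {2}/geps mulrA -hC -mulrA [e l * (1 - _)]mulrBr mulr1.
rewrite [RHS]geps_C !H (E_prod d) mulrN opprK; congr (h * (_ + _)).
by rewrite mulrA -EeC -mulrA geps_E mulrN EeC.
Qed.

(** The common product w commutes with the cyclic permutation p and with whatever commutes with
    eps_0 and eps_1. Hence [gd_c] applies to the involution 1 - 2w and makes w equal to 0 or 1; the
    value 1 would force e_0 = 1, against [gd_em]. *)
Lemma geps01 : e o0 * e o1 = 0.
Proof.
pose w := e o0 * e o1.
have ww : w * w = w.
  by rewrite /w mulrA -(mulrA (e o0)) -geps_C mulrA geps_id -mulrA geps_id.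
pose k := 1 - w - w.
have kk : k * k = 1.
  transitivity (1 + (w * w - w) + (w * w - w) + (w * w - w) + (w * w - w)).
    by rewrite /k; ncring.
  by rewrite ww subrr !addr0.
have [g gk] := ue_surj iotaP kk kk.
have kcomm a : a * w = w * a -> a * k = k * a.
  by move=> aw; rewrite /k !mulrBr !mulrBl mulr1 mul1r aw.
have [||h' h0 h1|g1|gm] := gd_c gd (g := g).
- by apply: (ue_inj iotaP); rewrite M gk kk (ue1 iotaP).
- apply: (ue_inj iotaP); rewrite !M gk; symmetry; apply: kcomm.
  have P0 : iota p * e o0 = e o1 * iota p.
    by apply: geps_move; rewrite -!M (gd_p0 gd).
  have P1 : iota p * e o1 = e o2 * iota p.
    by apply: geps_move; rewrite -!M (gd_p1 gd).
  by rewrite /w mulrA P0 -mulrA P1 mulrA (@geps_prod_shift o0 o1 o2).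
- apply: (ue_inj iotaP); rewrite !M gk; apply: kcomm.
  have H0 : iota h' * e o0 = e o0 * iota h' by apply: geps_comm; rewrite -!M h0.
  have H1 : iota h' * e o1 = e o1 * iota h' by apply: geps_comm; rewrite -!M h1.
  by rewrite /w mulrA H0 -mulrA H1 mulrA.
- move: gk; rewrite g1 (ue1 iotaP) /k -addrA -opprD => /eqP.
  rewrite eq_sym -subr_eq0 addrAC subrr sub0r oppr_eq0 => /eqP w0.
  by apply: (addrr_inj halfA); rewrite -/w w0 addr0.
- move: gk; rewrite gm iota_m /k => H.
  have w1 : w = 1.
    apply: (addrr_inj halfA); apply/eqP; rewrite -subr_eq0.
    by apply/eqP; transitivity (- 1 - (1 - w - w)); [ncring | rewrite H subrr].
  have e01 : e o0 = 1 by rewrite -[e o0]mulr1 -w1 /w mulrA geps_id.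
  case: (gd_em gd); apply: (ue_inj iotaP); rewrite iota_m.
  by have := geps_double o0; rewrite e01 => /addrI ->; rewrite opprK.
Qed.

Lemma geps_orthogonal : orthogonal_decomposition e.
Proof.
have e12 : e o1 * e o2 = 0 by rewrite (@geps_prod_shift o0 o1 o2) // geps01.
have e02 : e o0 * e o2 = 0 by rewrite (@geps_prod_shift o1 o0 o2) // geps_C geps01.
have d0 i j : i != j -> e i * e j = 0.
  case: (ord3P i) (ord3P j) => -> [] -> // _.
  - exact: geps01.
  - by rewrite geps_C geps01.
  - by rewrite geps_C.
  - by rewrite geps_C.
split=> [i j|].
  by have [->|ij] := eqVneq i j; [exact: geps_id | rewrite d0].
rewrite -(distinct3_sum e d012); apply: (addrr_inj halfA).
have E2 : E o2 = - (E o0 * E o1) by apply: E_prod.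
have eE i : E i = 1 - e i - e i by rewrite -geps_refl.
transitivity (e o0 + e o0 + (e o1 + e o1) + (e o2 + e o2)); first by ncring.
rewrite (geps_double o2) E2 (eE o0) (eE o1) opprK.
transitivity (1 + 1 + (e o0 * e o1 + e o0 * e o1 + e o0 * e o1 + e o0 * e o1)).
  by move: (e o0) (e o1) => *; ncring.
by rewrite geps01 !addr0.
Qed.

Let gx i j := iota (x i j).
Let gx' i j := iota (x i j)^-1%g.

Lemma good_steinberg : steinberg e gx gx'.
Proof.
have eP := geps_orthogonal.
split=> [i j _|i j _|i j k d|i j ij|i j k d|i j k d|i j k d|i j ij].
- exact: (ueV iotaP).
- exact: (ueVl iotaP).
- have D := distinct3P d.
  have ke : E i * e k = e k by rewrite -geps_refl refl_mulr_0 // D.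
  have ek : e k * E i = e k by rewrite -geps_refl refl_mull_0 // D.
  have ye : iota (y i j) * e k = e k * iota (y i j).
    by apply: geps_comm; rewrite -!M (gd_fix gd).
  (* On block k the reflection eps_i is the identity, and y_ij preserves the block, so [gd_inv] says
     there that y_ij has square 1. This is why x_ij is taken to be a square. *)
  have yy : e k * (iota (y i j) * iota (y i j)) = e k.
    have inv1 : E i * iota (y i j) * E i * iota (y i j) = 1.
      by rewrite -!M (gd_inv gd) ?(ue1 iotaP) ?D.
    have := congr1 (fun u => e k * u) inv1; rewrite mulr1 !mulrA ek.
    by rewrite -ye -[_ * e k * E i]mulrA ek ye.
  rewrite /fixes /gx !M; split=> //.
  by rewrite -[LHS]mulrA ye [LHS]mulrA ye -[LHS]mulrA.
- rewrite geps_refl /gx' /gx; apply: ueV_uniq => //; rewrite -!M -(ue1 iotaP).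
  congr iota; have inv1 := gd_inv gd ij.
  have H : (eps i * y i j * eps i = (y i j)^-1)%g.
    by apply: (mulIg (y i j)); rewrite inv1 mulVg.
  have -> : (eps i * sqy y i j * eps i = (eps i * y i j * eps i) * (eps i * y i j * eps i))%g.
    by rewrite /sqy !mulgA -(mulgA _ (eps i) (eps i)) (gd_ee gd) mulg1.
  by rewrite H /sqy -invgM mulgV.
- by rewrite /gx -!M (gd_st gd).
- by rewrite /gx -!M (gd_row gd).
- by rewrite /gx -!M (gd_col gd).
- rewrite -[LHS]mulrA (@geps_move i j); last by rewrite -!M (gd_weyl gd).
  by rewrite [LHS]mulrA odec_0 // mul0r.
Qed.

(** N has entries at (0,2) and (2,0) only, so eps_2 inverts 1 + N and the flip of 1 + N is its
    square 1 + 2N. The condition [gd_mix] at this element gives the two commutations after division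
    by 2. *)
Lemma good_unmixed b c : split_roots e b c ->
  (forall i j, i != j -> gx i j = 1 + b i j + c i j) ->
  forall N, N * N = 0 -> e o1 * N = 0 -> N * e o1 = 0 ->
  e o0 * N * e o0 = 0 -> e o2 * N * e o2 = 0 ->
  N * (b o0 o2 + c o0 o2) = (b o0 o2 + c o0 o2) * N ->
  N * (b o0 o1 + c o0 o1) = (b o0 o1 + c o0 o1) * N /\
  N * (b o1 o2 + c o1 o2) = (b o1 o2 + c o1 o2) * N.
Proof.
move=> bcP xE N NN N1 N1' N0 N2 NC.
have eP := geps_orthogonal.
have s1 : e o0 + e o1 + e o2 = 1 by rewrite (distinct3_sum e d012) eP.2.
have NE : N = e o0 * N * e o2 + e o2 * N * e o0.
  rewrite -{1}[N]mul1r -s1 !mulrDl N1 addr0.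
  have K u : u * N = u * N * e o0 + u * N * e o2.
    by rewrite -[LHS]mulr1 -s1 !mulrDr -[u * N * e o1]mulrA N1' mulr0 addr0.
  congr (_ + _); first by rewrite [LHS]K N0 add0r.
  by rewrite [LHS]K N2 addr0.
have rNr : E o2 * N * E o2 = - N.
  have a0 : E o2 * e o0 = e o0 by rewrite -geps_refl refl_mulr_0.
  have a0' : e o0 * E o2 = e o0 by rewrite -geps_refl refl_mull_0.
  have a2 : E o2 * e o2 = - e o2 by rewrite -geps_refl refl_mulr_id.
  transitivity ((E o2 * e o0) * N * (e o2 * E o2) + (E o2 * e o2) * N * (e o0 * E o2)).
    by rewrite {1}NE; move: (e o0) (e o2) (E o2) => *; ncring.
  by rewrite a0 a2 a0' geps_E mulrN !mulNr -opprD -NE.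
have [g gE] := ue_unip iotaP NN.
have g'E : iota g^-1%g = 1 - N.
  apply: (ueV_uniq iotaP); rewrite gE.
  by transitivity (1 - N * N); [ncring | rewrite NN subr0].
have dE : iota (g * eps o2 * g^-1 * eps o2)%g = 1 + (N + N).
  rewrite !M gE g'E.
  transitivity ((1 + N) * (E o2 * E o2 - E o2 * N * E o2)); first by ncring.
  rewrite rNr EE opprK.
  by transitivity (1 + (N + N) + N * N); [ncring | rewrite NN addr0].
have xS i j : i != j -> gx i j = 1 + (b i j + c i j) by move=> ij; rewrite xE // addrA.
have comm1 (u v : A) : u * (1 + v) = (1 + v) * u -> u * v = v * u.
  move=> H; apply: (addrI u); move: H.
  by rewrite mulrDr mulrDl mulr1 mul1r.
have comm2 (u v : A) : u * v = v * u -> (1 + u) * (1 + v) = (1 + v) * (1 + u).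
  move=> uv; transitivity (1 + u + v + u * v); first by ncring.
  by rewrite uv; ncring.
have dcomm (v : A) : iota (g * eps o2 * g^-1 * eps o2)%g * (1 + v) =
    (1 + v) * iota (g * eps o2 * g^-1 * eps o2)%g -> N * v = v * N.
  rewrite dE => /comm1 H; apply: (addrr_inj halfA).
  rewrite -mulrDl -mulrDr; symmetry; apply: (comm1 v).
  by rewrite H.
have [||H1 H2] := gd_mix gd (h := g).
- apply: (ue_inj iotaP); rewrite (M g) (M _ g) -/(gx o0 o2) xS // gE.
  exact: comm2.
- apply: (ue_inj iotaP); rewrite !M gE -geps_refl.
  have Nr : N * refl e o1 = N by rewrite /refl !mulrBr N1' mulr1 !subr0.
  have rN : refl e o1 * N = N by rewrite /refl !mulrBl N1 mul1r !subr0.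
  by rewrite [LHS]mulrDl [RHS]mulrDr Nr rN mul1r mulr1.
by split; apply: dcomm; rewrite -xS // -[LHS]M -[RHS]M; congr iota.
Qed.

Lemma good_roots : exists b c, [/\ split_roots e b c,
  forall i j, i != j -> iota (x i j) = 1 + b i j + c i j,
  forall i j, i != j -> iota (x i j)^-1%g = 1 - b i j - c i j &
  (forall i j, i != j -> c i j = 0) \/ (forall i j, i != j -> b i j = 0)].
Proof.
have eP := geps_orthogonal; have stP := good_steinberg.
exists (rootp e gx), (rootn e gx).
have bcP := st_split_roots eP stP; split=> //.
- by move=> i j ij; exact: (st_unip eP stP ij).
- by move=> i j ij; exact: (st_unipV eP stP ij).
apply: (root_dichotomy eP bcP d012) => //.
by apply: good_unmixed => // i j ij; exact: (st_unip eP stP ij).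
Qed.

Lemma good_q : iota q * e o0 = (1 - e o0) * iota q.
Proof.
have Q : iota q * E o0 = - E o0 * iota q.
  by rewrite -!M (gd_q gd) !M iota_m mulN1r.
have e1 : 1 - e o0 = h * (1 + E o0).
  apply: (addrI (e o0)); rewrite addrC subrK /geps -mulrDr.
  have -> : 1 - E o0 + (1 + E o0) = 1 + 1 by ncring.
  by rewrite mulrDr mulr1.
by rewrite e1 /geps mulrA -hC -!mulrA mulrBr mulr1 Q mulNr opprK mulrDl mul1r.
Qed.

End Fixed.

(** In the reversed case the group is embedded in the opposite ring through g -> iota g^-1. Then
    x_ij becomes 1 - c_ij, and the elements -c_ij are matrix units for the reversed product, so
    [coding_exists] applies there. *)
Lemma good_coding m p q eps y : good m p q eps y ->
  (exists code : A -> G,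
     coding (sqy y o0 o2) (sqy y o2 o1) (sqy y o1 o0) (eps o1) (eps o2) code) \/
  (exists code : A^c -> G,
     coding (sqy y o0 o2) (sqy y o2 o1) (sqy y o1 o0) (eps o1) (eps o2) code).
Proof.
move=> gd; have [h [hh hC]] := halfP halfA.
pose e := geps eps h.
have eP : orthogonal_decomposition e := geps_orthogonal gd hh hC.
have epsE i : iota (eps i) = refl e i by rewrite (geps_refl _ hh).
have epsV i : (eps i)^-1%g = eps i.
  by apply: (mulIg (eps i)); rewrite mulVg (gd_ee gd).
have qE : iota q * e o0 = (1 - e o0) * iota q := good_q gd hh hC.
have [b [c [bcP xE xVE [c0|b0]]]] := good_roots gd hh hC; [left|right].
  have bP : matrix_units e b.
    split=> [i j|i j|i j k d|i j ij].
    - exact: (sr_eb bcP).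
    - exact: (sr_be bcP).
    - exact: (sr_bb bcP).
    - by rewrite [RHS](sr_full bcP ij) c0 // 1?eq_sym // mul0r addr0.
  apply: (coding_exists halfA eP bP (ueV iotaP q) (ueVl iotaP q) qE iotaP);
    by rewrite ?epsE // xE // c0 ?addr0.
pose iota' (g : G) : A^c := iota (g^-1)%g.
have iota'P : unit_embedding iota'.
  split.
  - by rewrite /iota' invg1 (ue1 iotaP).
  - by move=> g k; rewrite /iota' invgM (ueM iotaP).
  - by move=> g k /(ue_inj iotaP)/invg_inj.
  - move=> a a' aa' a'a; have [g gE] : exists g, iota g = a := ue_surj iotaP a'a aa'.
    by exists (g^-1)%g; rewrite /iota' invgK.
have halfA' : contains_half A^c by have [k [k1 k2]] := halfA; exists k.
have eP' : @orthogonal_decomposition A^c e.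
  split=> [i j|]; last exact: eP.2.
  by rewrite -[LHS]/((e j : A) * e i) eP.1 eq_sym; case: eqP => [->|].
have bP : @matrix_units A^c e (fun i j => - c i j).
  split=> [i j|i j|i j k d|i j ij].
  - by rewrite -[LHS]/((- c i j : A) * e i) mulNr (sr_ce bcP).
  - by rewrite -[LHS]/((e j : A) * - c i j) mulrN (sr_ec bcP).
  - by rewrite -[LHS]/((- c j k : A) * - c i j) mulrNN (sr_cc bcP).
  - rewrite -[LHS]/((- c j i : A) * - c i j) mulrNN [RHS](sr_full bcP ij).
    by rewrite b0 // mul0r add0r.
have qV : iota q^-1%g * (1 - e o0) = e o0 * iota q^-1%g.
  transitivity (iota q^-1%g * ((1 - e o0) * iota q) * iota q^-1%g).
    by rewrite -!mulrA (ueV iotaP) mulr1.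
  by rewrite -qE mulrA (ueVl iotaP) mul1r.
apply: (@coding_exists A^c e halfA' eP' _ bP (iota q^-1%g) (iota q)
  _ _ _ G iota' iota'P).
- by rewrite -[LHS]/((iota q : A) * _) (ueV iotaP).
- by rewrite -[LHS]/((iota q^-1%g : A) * _) (ueVl iotaP).
- by rewrite -[LHS]/((e o0 : A) * _) -qV.
- by rewrite /iota' xVE // b0 // subr0.
- by rewrite /iota' xVE // b0 // subr0.
- by rewrite /iota' xVE // b0 // subr0.
- by rewrite /iota' epsV epsE.
- by rewrite /iota' epsV epsE.
Qed.
End GoodStructure.

(* For A = End V, an isomorphism of V with V + V. *)
Record self_double (A : pzRingType) (s0 s1 t0 t1 : A) : Prop := SelfDouble {
  sd00 : t0 * s0 = 1; sd11 : t1 * s1 = 1; sd01 : t0 * s1 = 0; sd10 : t1 * s0 = 0;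
  sd1 : s0 * t0 + s1 * t1 = 1 }.

(** * A tuple that satisfies the conditions *)

Section Standard.
Variables (A : pzRingType) (s0 s1 t0 t1 : A).
Hypothesis sd : self_double s0 s1 t0 t1.
Variables (G : groupType) (iota : G -> A).
Hypothesis iotaP : unit_embedding iota.

(** The units 1 + n account for all n of square zero, and these generate the ring: in the
    decomposition by s0 t0 and s1 t1 the off-diagonal parts have square zero, and each diagonal part
    is a product of two off-diagonal ones. *)
Lemma commutes_with_units (c : A) : (forall g, iota g * c = c * iota g) ->
  forall a, GRing.comm c a.
Proof.
move=> cu.
have nil n : n * n = 0 -> GRing.comm c n.
  move=> /(ue_unip iotaP)[g gE]; apply/esym; have := cu g.
  by rewrite gE mulrDl mulrDr mul1r mulr1 => /addrI.
have off0 a : GRing.comm c (s0 * t0 * a * (s1 * t1)).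
  apply: nil; rewrite -!mulrA (mulrA t1) (sd10 sd) !(mul0r, mulr0) //.
have off1 a : GRing.comm c (s1 * t1 * a * (s0 * t0)).
  apply: nil; rewrite -!mulrA (mulrA t0 s1) (sd01 sd) !(mul0r, mulr0) //.
have sw0 : GRing.comm c (s1 * t0).
  by apply: nil; rewrite -!mulrA (mulrA t0) (sd01 sd) !(mul0r, mulr0).
have sw1 : GRing.comm c (s0 * t1).
  by apply: nil; rewrite -!mulrA (mulrA t1) (sd10 sd) !(mul0r, mulr0).
have d0 a : GRing.comm c (s0 * t0 * a * (s0 * t0)).
  have -> : s0 * t0 * a * (s0 * t0) =
      (s0 * t0 * (a * s0 * t1) * (s1 * t1)) * (s1 * t0).
    rewrite -!mulrA (mulrA t1 s1 (t0)) (sd11 sd) mul1r.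
    by rewrite (mulrA t1 s1) (sd11 sd) mul1r.
  exact: commrM.
have d1 a : GRing.comm c (s1 * t1 * a * (s1 * t1)).
  have -> : s1 * t1 * a * (s1 * t1) =
      (s1 * t1 * (a * s1 * t0) * (s0 * t0)) * (s0 * t1).
    rewrite -!mulrA (mulrA t0 s0 t1) (sd00 sd) mul1r.
    by rewrite (mulrA t0 s0) (sd00 sd) mul1r.
  exact: commrM.
move=> a; have -> : a = s0 * t0 * a * (s0 * t0) + s0 * t0 * a * (s1 * t1) +
    (s1 * t1 * a * (s0 * t0) + s1 * t1 * a * (s1 * t1)).
  by rewrite -!mulrDr (sd1 sd) !mulr1 -mulrDl (sd1 sd) mul1r.
by apply: commrD; apply: commrD.
Qed.

Fact sdu_key : unit. Proof. by []. Qed.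
(** Doubling the second summand of V + V once more gives three copies of V. *)
Definition sd_in (i : 'I_3) := locked_with sdu_key
  (if i == o0 then s0 else if i == o1 then s1 * s0 else s1 * s1).
Definition sd_out (i : 'I_3) := locked_with sdu_key
  (if i == o0 then t0 else if i == o1 then t0 * t1 else t1 * t1).
Definition sdu i j := locked_with sdu_key (sd_in i * sd_out j).
Local Notation E := sdu.
Local Notation e := (fun i => sdu i i).

Lemma sduE i j : E i j = sd_in i * sd_out j.
Proof. by rewrite /sdu unlock. Qed.

Lemma sd_out_in i j : sd_out i * sd_in j = if i == j then 1 else 0.
Proof.
case: (ord3P i) (ord3P j) => -> [] ->; rewrite /sd_out /sd_in !unlock /=.
- exact: sd00 sd.
- by rewrite mulrA (sd01 sd) mul0r.
- by rewrite mulrA (sd01 sd) mul0r.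
- by rewrite -mulrA (sd10 sd) mulr0.
- by rewrite -mulrA (mulrA t1 s1) (sd11 sd) mul1r (sd00 sd).
- by rewrite -mulrA (mulrA t1 s1) (sd11 sd) mul1r (sd01 sd).
- by rewrite -mulrA (sd10 sd) mulr0.
- by rewrite -mulrA (mulrA t1 s1) (sd11 sd) mul1r (sd10 sd).
- by rewrite -mulrA (mulrA t1 s1) (sd11 sd) mul1r (sd11 sd).
Qed.

Lemma sduM i j k l : E i j * E k l = if j == k then E i l else 0.
Proof.
rewrite !sduE -mulrA (mulrA (sd_out j)) sd_out_in.
by case: eqP; rewrite ?mul1r // mul0r mulr0.
Qed.

Lemma sdu_out_in i j : sd_out i * E i j * sd_in j = 1.
Proof. by rewrite sduE mulrA sd_out_in eqxx mul1r sd_out_in eqxx. Qed.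

Lemma sdu_orthogonal : orthogonal_decomposition e.
Proof.
split=> [i j|]; first by rewrite sduM; case: eqP => [->|].
rewrite -(distinct3_sum _ d012) !sduE /sd_in /sd_out !unlock /=.
have -> : s1 * s0 * (t0 * t1) = s1 * (s0 * t0) * t1 by rewrite !mulrA.
have -> : s1 * s1 * (t1 * t1) = s1 * (s1 * t1) * t1 by rewrite !mulrA.
by rewrite -addrA -mulrDl -mulrDr (sd1 sd) mulr1 (sd1 sd).
Qed.

Lemma sdu_matrix_units : matrix_units e E.
Proof.
split=> [i j|i j|i j k /distinct3P D|i j ij]; by rewrite sduM eqxx.
Qed.

Hypothesis halfA : contains_half A.
Hypothesis connA : no_nontrivial_central_idempotent A.
Hypothesis neq10 : (1 : A) <> 0.

Lemma good_exists : exists m p q eps y, @good G m p q eps y /\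
  exists code : A -> G,
    coding (sqy y o0 o2) (sqy y o2 o1) (sqy y o1 o0) (eps o1) (eps o2) code.
Proof.
have eP := sdu_orthogonal; have EP := sdu_matrix_units.
have [h [hh hC]] := halfP halfA.
have EM := sduM; have M := ueM iotaP; have inj := ue_inj iotaP.
have [m mE] : exists g, iota g = -1 by apply: (ue_surj iotaP (b := -1)); rewrite mulrNN mulr1.
have [p pE] : exists g, iota g = E o1 o0 + E o2 o1 + E o0 o2.
  apply: (ue_surj iotaP (b := E o0 o1 + E o1 o2 + E o2 o0));
  rewrite !mulrDl !mulrDr !EM /= !(addr0, add0r) -[RHS]eP.2 -(distinct3_sum _ d012).
    by rewrite addrC addrA.
  by [].
have [q qE] : exists g, iota g = s0 * t1 + s1 * t0.
  have qq : (s0 * t1 + s1 * t0) * (s0 * t1 + s1 * t0) = 1.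
    transitivity (s0 * (t1 * s0) * t1 + s0 * (t1 * s1) * t0 +
                  (s1 * (t0 * s0) * t1 + s1 * (t0 * s1) * t0)); first by ncring.
    by rewrite (sd00 sd) (sd10 sd) (sd01 sd) (sd11 sd) !(mulr0, mul0r, mulr1)
      add0r addr0 (sd1 sd).
  exact: (ue_surj iotaP qq qq).
have /choice[eps epsE] : forall i, exists g, iota g = refl e i.
  by move=> i; apply: (ue_surj iotaP (b := refl e i)); exact: refl_sq eP i.
have Enil i j : i != j -> E i j * E i j = 0 by rewrite EM eq_sym => /negbTE ->.
have /choice[y0 y0E] : forall u : 'I_3 * 'I_3, exists g,
    u.1 != u.2 -> iota g = 1 + h * E u.1 u.2.
  move=> [i j] /=; have [//|ij] := eqVneq i j; first by exists 1%g.
  have [|g gE] := ue_unip iotaP (n := h * E i j); last by exists g.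
  by rewrite mulrA -(mulrA h) -hC -!mulrA Enil // !mulr0.
pose y i j := y0 (i, j).
have yE i j : i != j -> iota (y i j) = 1 + h * E i j by move=> /(y0E (i, j)).
have xE i j : i != j -> iota (sqy y i j) = 1 + E i j.
  move=> ij; rewrite /sqy M yE //.
  transitivity (1 + (h + h) * E i j + h * (E i j * h) * E i j); first by ncring.
  by rewrite -hC -!mulrA Enil // !mulr0 addr0 hh mul1r.
have xVE i j : i != j -> iota (sqy y i j)^-1%g = 1 - E i j.
  move=> ij; apply: (ueV_uniq iotaP); rewrite xE //.
  by transitivity (1 - E i j * E i j); [ncring | rewrite Enil // subr0].
have refl_move i j a : a * e i = e j * a -> a * refl e i = refl e j * a.
  by move=> ae; rewrite /refl !mulrBr !mulrBl mulr1 mul1r ae.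
have e0E : E o0 o0 = s0 * t0 by rewrite sduE /sd_in /sd_out !unlock.
have Q0 : iota q * E o0 o0 = s1 * t0.
  rewrite qE e0E mulrDl -mulrA (mulrA t1) (sd10 sd) mul0r mulr0 add0r.
  by rewrite -mulrA (mulrA t0) (sd00 sd) mul1r.
have Q1 : E o0 o0 * iota q = s0 * t1.
  rewrite qE e0E mulrDr -mulrA (mulrA t0) (sd00 sd) mul1r.
  by rewrite -mulrA (mulrA t0) (sd01 sd) mul0r mulr0 addr0.
exists m, p, q, eps, y; split; last first.
  have qe : iota q * e o0 = (1 - e o0) * iota q.
    by rewrite mulrBl mul1r Q0 Q1 qE addrC addKr.
  by apply: (coding_exists halfA eP EP (ueV iotaP q) (ueVl iotaP q) qe iotaP);
    rewrite ?epsE ?xE.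
split.
- by move=> g; apply: inj; rewrite !M mE mulrN1 mulN1r.
- by apply: inj; rewrite M mE mulrNN mulr1 (ue1 iotaP).
- move=> /(congr1 iota); rewrite mE (ue1 iotaP) => H; apply: neq10.
  by rewrite -hh -{1}[h]mulr1 -H mulrN1 addNr.
- by move=> i; apply: inj; rewrite M epsE (refl_sq eP) (ue1 iotaP).
- move=> i j; apply: inj; rewrite !M !epsE; symmetry; apply: refl_move.
  rewrite /refl !mulrBr !mulrBl mulr1 mul1r !EM eq_sym.
  by case: eqP => [->|].
- apply: inj; rewrite !M !epsE mE.
  transitivity (1 - (e o0 + e o1 + e o2) - (e o0 + e o1 + e o2)
    + (e o0 * e o1 + e o0 * e o2 + e o1 * e o2 + e o0 * e o1 + e o0 * e o2 + e o1 * e o2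
    + e o0 * e o1 + e o0 * e o2 + e o1 * e o2 + e o0 * e o1 + e o0 * e o2 + e o1 * e o2)
    - (e o0 * e o1 + e o0 * e o1 + e o0 * e o1 + e o0 * e o1
      + e o0 * e o1 + e o0 * e o1 + e o0 * e o1 + e o0 * e o1) * e o2).
    by rewrite /refl; move: (E o0 o0) (E o1 o1) (E o2 o2) => *; ncring.
  rewrite !EM /= !addr0 mul0r subr0 (distinct3_sum e d012) eP.2.
  by rewrite subrr sub0r.
- move=> /(congr1 iota); rewrite epsE mE /refl -addrA -opprD => H.
  have e01 : E o0 o0 = 1.
    apply: (addrr_inj halfA); apply: oppr_inj; apply: (addrI 1); rewrite H.
    by rewrite opprD addrA subrr add0r.
  have E11 : E o1 o1 = 0.
    by transitivity (E o1 o1 * E o0 o0); [rewrite e01 mulr1 | rewrite EM].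
  by apply: neq10; rewrite -(sdu_out_in o1 o1) E11 mulr0 mul0r.
- apply: inj; rewrite !M !epsE; apply: refl_move.
  by rewrite pE mulrDr !mulrDl !mulrDr !EM /= !(addr0, add0r).
- apply: inj; rewrite !M !epsE; apply: refl_move.
  by rewrite pE mulrDr !mulrDl !mulrDr !EM /= !(addr0, add0r).
- move=> g gg gp gC.
  have cE i : i != o2 -> iota g * e i = e i * iota g.
    move=> i2; have epsC j : (eps i * eps j = eps j * eps i)%g.
      apply: inj; rewrite !M !epsE; symmetry; apply: refl_move.
      rewrite /refl !mulrBr !mulrBl mulr1 mul1r !EM eq_sym.
      by case: eqP => [->|].
    have := congr1 iota (gC (eps i) (epsC o0) (epsC o1)).
    by rewrite !M epsE => /esym; exact: refl_comm.
  have s3 : E o0 o0 + E o1 o1 + E o2 o2 = 1 by rewrite (distinct3_sum e d012) eP.2.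
  have cE2 : iota g * e o2 = e o2 * iota g.
    have -> : E o2 o2 = 1 - E o0 o0 - E o1 o1.
      by rewrite -s3; move: (E o0 o0) (E o1 o1) (E o2 o2) => *; ncring.
    by rewrite !mulrBr !mulrBl mulr1 mul1r !cE.
  have cEa i : iota g * e i = e i * iota g.
    by case: (ord3P i) => ->; [exact: cE | exact: cE | exact: cE2].
  have gP : iota p * iota g = iota g * iota p by rewrite -!M gp.
  have shift i j : iota p * e i = E j i -> E j i * iota g * E i j = e j * iota g * e j.
    move=> Pi; have PE : iota p * E i j = e j.
      by rewrite -[E i j](mu_eb EP) mulrA Pi EM eqxx.
    transitivity (iota p * iota g * (E i i * E i j)).
      by rewrite -Pi -[_ * _ * iota g]mulrA -cEa !mulrA.
    by rewrite EM eqxx gP -mulrA PE -cEa -mulrA EM eqxx.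
  have s10 : iota p * e o0 = E o1 o0 by rewrite pE !mulrDl !EM /= !addr0.
  have s21 : iota p * e o1 = E o2 o1 by rewrite pE !mulrDl !EM /= addr0 add0r.
  pose c := sd_out o0 * iota g * sd_in o0.
  have cB i : E i o0 * iota g * E o0 i = e i * iota g.
    have idE j : e j * iota g * e j = e j * iota g.
      by rewrite -mulrA cEa mulrA EM eqxx.
    case: (ord3P i) => ->; rewrite -[RHS]idE //; first exact: shift.
    have -> : E o2 o0 * iota g * E o0 o2 = E o2 o1 * (E o1 o0 * iota g * E o0 o1) * E o1 o2.
      by rewrite !mulrA EM -!mulrA EM.
    by rewrite (shift _ _ s10) idE mulrA EM /=; exact: shift.
  (* [dg a] repeats a along the diagonal. Commuting with the reflections and with p, g is of the
     form [dg c]. For every unit k, [dg k] centralizes eps_0 and eps_1, so it commutes with g; hence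
     c is central and g equals c. *)
  pose dg a := sd_in o0 * a * sd_out o0 + sd_in o1 * a * sd_out o1 +
    sd_in o2 * a * sd_out o2.
  have dg_in a i : dg a * sd_in i = sd_in i * a.
    by case: (ord3P i) => ->; rewrite /dg !mulrDl -!mulrA !sd_out_in /=
      !(mulr0, mulr1) !(addr0, add0r).
  have dg_out a i : sd_out i * dg a = a * sd_out i.
    by case: (ord3P i) => ->; rewrite /dg !mulrDr !mulrA !sd_out_in /=
      !(mul0r, mul1r) !(addr0, add0r).
  have dgM a a' : dg a * dg a' = dg (a * a').
    by rewrite {2}/dg !mulrDr !mulrA !dg_in /dg !mulrA.
  have dg1 : dg 1 = 1 by rewrite /dg !mulr1 -s3 !sduE.
  have gE : iota g = dg c.
    transitivity (E o0 o0 * iota g + E o1 o1 * iota g + E o2 o2 * iota g).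
      by rewrite -!mulrDl s3 mul1r.
    by rewrite /dg; congr (_ + _ + _); rewrite -[LHS]cB /c !sduE !mulrA.
  have cu k : iota k * c = c * iota k.
    have [||k' k'E] := @ue_surj _ _ _ iotaP (dg (iota k)) (dg (iota k^-1%g)).
    - by rewrite dgM (ueV iotaP).
    - by rewrite dgM (ueVl iotaP).
    have kE i : iota k' * e i = e i * iota k'.
      by rewrite k'E sduE mulrA dg_in -!mulrA dg_out.
    have := congr1 iota (gC k' _ _); rewrite !M k'E => H.
    have {}H : dg (iota k) * iota g = iota g * dg (iota k).
      by apply: H; apply: inj; rewrite !M epsE; apply: refl_move.
    have := congr1 (fun a => sd_out o0 * a * sd_in o0) H.
    by rewrite !mulrA dg_out -[RHS]mulrA dg_in /c !mulrA.
  have cA := commutes_with_units cu.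
  have gc : iota g = c.
    have cS i : sd_in i * c * sd_out i = c * (sd_in i * sd_out i).
      by rewrite -[sd_in i * c]cA mulrA.
    by rewrite gE /dg !cS -!mulrDr -[RHS]mulr1 -dg1 /dg !mulr1.
  have [g1|g1] := boolp.EM (g = 1%g); [by left | right; apply: (ue_inj iotaP); rewrite mE].
  apply: (central_involution halfA connA iotaP) => //; first exact: commutes_with_units.
  by move=> k; apply: inj; rewrite !M gc cu.
- apply: inj; rewrite !M mE epsE mulN1r mulNr.
  rewrite {1}/refl !mulrBr mulr1 Q0 /refl !mulrBl mul1r Q1 qE.
  by move: (s0 * t1) (s1 * t0) => *; ncring.
- move=> i j k d; have D := distinct3P d; have F := distinct3F d.
  apply: inj; rewrite !M epsE yE ?D //.
  symmetry; apply: refl_move; rewrite mulrDl mulrDr mul1r mulr1.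
  by rewrite -mulrA EM mulrA -hC -mulrA EM !F.
- move=> i j ij; apply: inj; rewrite !M epsE yE // (ue1 iotaP).
  have rE : refl e i * E i j = - E i j.
    by rewrite /refl !mulrBl mul1r !EM eqxx subrr sub0r.
  have Er : E i j * refl e i = E i j.
    by rewrite /refl !mulrBr mulr1 !EM eq_sym (negbTE ij) !subr0.
  have -> : refl e i * (1 + h * E i j) * refl e i = 1 - h * E i j.
    transitivity (refl e i * refl e i + refl e i * h * (E i j * refl e i)).
      by move: (refl e i) (E i j) => *; ncring.
    by rewrite (refl_sq eP) -hC Er -mulrA rE mulrN.
  transitivity (1 - h * (E i j * h) * E i j); first by ncring.
  by rewrite -hC -!mulrA Enil // !mulr0 subr0.
- move=> i j k d; have D := distinct3P d; have F := distinct3F d.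
  apply: inj; move: (sqy y) xE => X XE.
  rewrite !M !XE ?D //.
  rewrite !mulrDl !mulrDr !mulr1 !mul1r !EM !eqxx !F !(addr0, add0r).
  by move: (E i j) (E j k) (E i k) => *; ncring.
- move=> i j k d; have D := distinct3P d; have F := distinct3F d.
  apply: inj; move: (sqy y) xE => X XE.
  rewrite !M !XE ?D //.
  by rewrite !mulrDl !mulrDr !mulr1 !mul1r !EM !F !addr0 addrAC.
- move=> i j k d; have D := distinct3P d; have F := distinct3F d.
  apply: inj; move: (sqy y) xE => X XE.
  rewrite !M !XE ?D //.
  by rewrite !mulrDl !mulrDr !mulr1 !mul1r !EM !F !addr0 addrAC.
- move=> i j ij; have ji : j != i by rewrite eq_sym.
  apply: inj; move: (sqy y) xE xVE => X XE XVE.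
  rewrite !M !epsE !XE // XVE //; apply: refl_move.
  have h1 : (1 + E i j) * e i = e i by rewrite mulrDl mul1r EM (negbTE ji) addr0.
  have h2 : (1 - E j i) * e i = e i - E j i by rewrite mulrBl mul1r EM eqxx.
  have h3 : (1 + E i j) * (e i - E j i) = - E j i.
    by rewrite mulrDl mul1r mulrBr !EM !eqxx (negbTE ji) sub0r addrAC subrr sub0r.
  have k1 : e j * (1 + E i j) = e j by rewrite mulrDr mulr1 EM (negbTE ji) addr0.
  have k2 : e j * (1 - E j i) = e j - E j i by rewrite mulrBr mulr1 EM eqxx.
  have k3 : (e j - E j i) * (1 + E i j) = - E j i.
    by rewrite mulrDr mulr1 mulrBl !EM !eqxx (negbTE ji) sub0r addrAC subrr sub0r.
  rewrite -[LHS]mulrA h1 -[LHS]mulrA h2 h3.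
  by rewrite [RHS]mulrA [in RHS]mulrA k1 k2 k3.
- move=> k /(congr1 iota) kx /(congr1 iota) ke.
  rewrite (M k) (M _ k) xE // in kx; rewrite (M k) (M _ k) epsE in ke.
  have [n dn en] := root_subgroup_shape halfA eP EP (ueV iotaP k) (ueVl iotaP k) kx ke.
  have dE : iota (k * eps o2 * k^-1 * eps o2)%g = 1 + n by rewrite !M epsE.
  have en0 : e o0 * n = n by rewrite -[RHS]en -{1}en !mulrA EM eqxx.
  have en2 : n * e o2 = n by rewrite -[RHS]en -{1}en -!mulrA EM eqxx.
  have comm u : n * u = 0 -> u * n = 0 -> (1 + n) * (1 + u) = (1 + u) * (1 + n).
    move=> nu un; rewrite !mulrDl !mulrDr !mulr1 !mul1r nu un !addr0 addrAC.
    by [].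
  split; apply: inj; rewrite !(M (k * _ * _ * _)%g) !(M (sqy _ _ _)) dE xE //;
    apply: comm.
  - by rewrite (mule_mul0 eP en2 (mu_eb EP _ _)).
  - by rewrite (mule_mul0 eP (mu_be EP _ _) en0).
  - by rewrite (mule_mul0 eP en2 (mu_eb EP _ _)).
  - by rewrite (mule_mul0 eP (mu_be EP _ _) en0).
Qed.
End Standard.

(** * The interpreting formulas *)

Definition FIf (L : language) (b : bool) (phi : formula L) : formula L :=
  if b then phi else FNot (@Falsum L).

Lemma holds_if (L : language) (M : model L) (e : nat -> M) b phi :
  holds e (FIf b phi) <-> (b -> holds e phi).
Proof. by case: b => /=; split=> // h; exact: h. Qed.

Section GroupFormulas.
Local Open Scope nat_scope.
Local Notation V := (@Var group_language).
Local Notation "t =~ u" := (@Equal group_language t u) (at level 70).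
Local Notation "t ** u" := (gmul t u) (at level 40, left associativity).

(* Variables 0-14 hold the parameters, 15 and 16 are bound, and the variable n
   of a formula on rings becomes the variable 17 + n. *)
Definition v_m := V 0.
Definition v_p := V 1.
Definition v_q := V 2.
Definition v_eps (i : 'I_3) := V (3 + i).
Definition v_y (i j : 'I_3) := V (6 + 3 * i + j).
Definition v_x i j := v_y i j ** v_y i j.
Definition v_weyl i j := v_x i j ** ginv (v_x j i) ** v_x i j.
Definition v_flip := V 15 ** v_eps o2 ** ginv (V 15) ** v_eps o2.
Definition commF t u := t ** u =~ u ** t.

Definition good_formula : formula group_language :=
  FAnd (Forall 15 (V 15 ** v_m =~ v_m ** V 15))
  (FAnd (v_m ** v_m =~ gone)
  (FAnd (FNot (v_m =~ gone))
  (FAnd (FAll (fun i => v_eps i ** v_eps i =~ gone))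
  (FAnd (FAll (fun i => FAll (fun j => commF (v_eps i) (v_eps j))))
  (FAnd (v_eps o0 ** v_eps o1 ** v_eps o2 =~ v_m)
  (FAnd (FNot (v_eps o0 =~ v_m))
  (FAnd (v_p ** v_eps o0 =~ v_eps o1 ** v_p)
  (FAnd (v_p ** v_eps o1 =~ v_eps o2 ** v_p)
  (FAnd (Forall 15 (Defs.Implies (V 15 ** V 15 =~ gone)
    (Defs.Implies (commF (V 15) v_p)
    (Defs.Implies (Forall 16 (Defs.Implies (commF (V 16) (v_eps o0))
       (Defs.Implies (commF (V 16) (v_eps o1)) (commF (V 16) (V 15)))))
    (FOr (V 15 =~ gone) (V 15 =~ v_m))))))
  (FAnd (v_q ** v_eps o0 =~ v_m ** v_eps o0 ** v_q)
  (FAnd (FAll (fun i => FAll (fun j => FAll (fun k => FIf (distinct3 i j k)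
     (commF (v_eps k) (v_y i j))))))
  (FAnd (FAll (fun i => FAll (fun j => FIf (i != j)
     (v_eps i ** v_y i j ** v_eps i ** v_y i j =~ gone))))
  (FAnd (FAll (fun i => FAll (fun j => FAll (fun k => FIf (distinct3 i j k)
     (v_x i j ** v_x j k =~ v_x i k ** (v_x j k ** v_x i j))))))
  (FAnd (FAll (fun i => FAll (fun j => FAll (fun k => FIf (distinct3 i j k)
     (commF (v_x i j) (v_x i k))))))
  (FAnd (FAll (fun i => FAll (fun j => FAll (fun k => FIf (distinct3 i j k)
     (commF (v_x i k) (v_x j k))))))
  (FAnd (FAll (fun i => FAll (fun j => FIf (i != j)
     (v_weyl i j ** v_eps i =~ v_eps j ** v_weyl i j))))
  (Forall 15 (Defs.Implies (commF (V 15) (v_x o0 o2))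
     (Defs.Implies (commF (V 15) (v_eps o1))
     (FAnd (commF v_flip (v_x o0 o1)) (commF v_flip (v_x o1 o2))))))
  )))))))))))))))).

Definition p_eps (G : Type) (e : nat -> G) (i : 'I_3) := e (3 + i).
Definition p_y (G : Type) (e : nat -> G) (i j : 'I_3) := e (6 + 3 * i + j).

Lemma holds_good (G : groupType) (e : nat -> group_model G) :
  holds e good_formula <-> @good G (e 0) (e 1) (e 2) (p_eps e) (p_y e).
Proof.
have ho F : @holds _ (group_model G) e (FAll F) -> forall i, holds e (F i).
  by move/holds_all.
have hi b F : @holds _ (group_model G) e (FIf b F) -> b -> holds e F.
  by move/holds_if.
rewrite /good_formula !holds_and; split.
  case=> h0 [h1 [h2 [h3 [h4 [h5 [h6 [h7 [h8 [h9 [h10 [h11 [h12 [h13 [h14 [h15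
    [h16 h17]]]]]]]]]]]]]]]].
  split.
  - exact: h0.
  - exact: h1.
  - exact: h2.
  - by move=> i; exact: (ho _ _ h3 i).
  - by move=> i j; exact: (ho _ _ (ho _ _ h4 i) j).
  - exact: h5.
  - exact: h6.
  - exact: h7.
  - exact: h8.
  - move=> g gg gp gC; apply: (iffLR (@holds_or _ (group_model G)
      (updv e 15 g) (V 15 =~ gone) (V 15 =~ v_m))); exact: (h9 g).
  - exact: h10.
  - by move=> i j k; exact: (hi _ _ (ho _ _ (ho _ _ (ho _ _ h11 i) j) k)).
  - by move=> i j; exact: (hi _ _ (ho _ _ (ho _ _ h12 i) j)).
  - by move=> i j k; exact: (hi _ _ (ho _ _ (ho _ _ (ho _ _ h13 i) j) k)).
  - by move=> i j k; exact: (hi _ _ (ho _ _ (ho _ _ (ho _ _ h14 i) j) k)).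
  - by move=> i j k; exact: (hi _ _ (ho _ _ (ho _ _ (ho _ _ h15 i) j) k)).
  - by move=> i j; exact: (hi _ _ (ho _ _ (ho _ _ h16 i) j)).
  - move=> g gx ge; apply: (iffLR (@holds_and _ (group_model G) (updv e 15 g)
      (commF v_flip (v_x o0 o1)) (commF v_flip (v_x o1 o2)))); exact: (h17 g).
case=> h0 h1 h2 h3 h4 h5 h6 h7 h8 h9 h10 h11 h12 h13 h14 h15 h16 h17.
do !(split; first by
  [exact: h0|exact: h1|exact: h2|exact: h5|exact: h6|exact: h7|exact: h8|exact: h10
  |apply/holds_all => i; exact: h3
  |apply/holds_all => i; apply/holds_all => j; exact: h4
  |move=> g gg gp gC; apply: (iffRL (@holds_or _ (group_model G)
     (updv e 15 g) (V 15 =~ gone) (V 15 =~ v_m)));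
   exact: (h9 g)
  |apply/holds_all => i; apply/holds_all => j; apply/holds_all => k;
   apply/holds_if; exact: h11
  |apply/holds_all => i; apply/holds_all => j; apply/holds_if; exact: h12
  |apply/holds_all => i; apply/holds_all => j; apply/holds_all => k;
   apply/holds_if; exact: h13
  |apply/holds_all => i; apply/holds_all => j; apply/holds_all => k;
   apply/holds_if; exact: h14
  |apply/holds_all => i; apply/holds_all => j; apply/holds_all => k;
   apply/holds_if; exact: h15
  |apply/holds_all => i; apply/holds_all => j; apply/holds_if; exact: h16]).
move=> g gx ge; apply: (iffRL (@holds_and _ (group_model G) (updv e 15 g)
  (commF v_flip (v_x o0 o1)) (commF v_flip (v_x o1 o2)))); exact: (h17 g).
Qed.

Fixpoint trt (t : term ring_language) : term group_language :=
  match t with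
  | Var n => V (17 + n)
  | App s args =>
      match s return ('I_(@arity ring_language s) -> term group_language) ->
                     term group_language with
      | RZero => fun=> gone
      | ROne => fun=> v_x o0 o2
      | ROpp => fun a => ginv (a ord0)
      | RAdd => fun a => a ord0 ** a ord_max
      | RMul => fun a =>
          gcomm (gcomm (a ord0) (v_x o2 o1)) (gcomm (v_x o1 o0) (a ord_max))
      end (fun i => trt (args i))
  end.

Definition domF (v : nat) : formula group_language :=
  FEx 15 (FAnd (commF (V 15) (v_x o0 o2))
         (FAnd (commF (V 15) (v_eps o1)) (V v =~ v_flip))).

Fixpoint trf (phi : formula ring_language) : formula group_language :=
  match phi with
  | Equal t u => trt t =~ trt u
  | Falsum => Falsum
  | Defs.Implies a b => Defs.Implies (trf a) (trf b)
  | Forall k a => Forall (17 + k) (Defs.Implies (domF (17 + k)) (trf a))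
  end.

Section Correctness.
Variables (G : groupType) (P : nat -> G) (B : pzRingType) (code : B -> G).
Hypothesis codeP : coding (sqy (p_y P) o0 o2) (sqy (p_y P) o2 o1)
  (sqy (p_y P) o1 o0) (p_eps P o1) (p_eps P o2) code.

Lemma trt_correct (e : nat -> group_model G) (r : nat -> ring_model B) t :
  (forall n, n < 15 -> e n = P n) ->
  (forall n, occurs n t -> e (17 + n) = code (r n)) ->
  eval e (trt t) = code (eval r t).
Proof.
have [_ [_ [c0 c1 cN cD cM]]] := codeP => eP.
elim: t => [n|s args IH] er /=; first exact: er.
have {}IH i : eval e (trt (args i)) = code (eval r (args i)).
  by apply: IH => n oc; apply: er; exists i.
case: s args IH er => args IH er /=.
- by rewrite c0.
- by rewrite c1 /sqy /p_y !eP.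
- by rewrite IH cN.
- by rewrite !IH cD.
- by rewrite !IH cM /commutator /sqy /p_y !eP.
Qed.

Lemma holds_domF (e : nat -> group_model G) v : 16 < v ->
  (forall n, n < 15 -> e n = P n) ->
  holds e (domF v) <-> exists a, code a = e v.
Proof.
have [_ [dom _]] := codeP => v16 eP; rewrite holds_ex dom.
have v15 : (v == 15) = false by apply/eqP => v15; rewrite v15 in v16.
have [e4 e5 e8] : [/\ e 4 = P 4, e 5 = P 5 & e 8 = P 8] by split; exact: eP.
split=> -[h]; rewrite ?holds_and.
  case=> h1 [h2 h3]; exists h; move: h1 h2 h3; rewrite /= /updv /= v15 e4 e5 e8.
  by move=> h1 h2 h3; split.
case=> h1 h2 h3; exists h; rewrite !holds_and /= /updv /= v15 e4 e5 e8.
by split=> //; split.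
Qed.

Lemma trf_correct phi : forall (e : nat -> group_model G) (r : nat -> ring_model B),
  (forall n, n < 15 -> e n = P n) ->
  (forall n, free_in n phi -> e (17 + n) = code (r n)) ->
  holds e (trf phi) <-> holds r phi.
Proof.
have [inj [dom _]] := codeP.
elim: phi => [t u|//|a IHa b IHb|k a IH] e r eP er.
- rewrite /= (trt_correct (r := r)) // ?(trt_correct (r := r)) //.
  + by split=> [/inj|->].
  + by move=> n oc; apply: er; right.
  + by move=> n oc; apply: er; left.
- rewrite /= (IHa e r) ?(IHb e r) // => n fn; apply: er; by [left|right].
- have eP' (x : G) : forall n, n < 15 -> updv e (17 + k) x n = P n.
    move=> n n15; rewrite /updv -eP //; case: eqP => // nE; move: n15.
    by rewrite nE ltnNge (leq_trans _ (leq_addr k 17)).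
  have er' b : forall n, free_in n a ->
      updv e (17 + k) (code b) (17 + n) = code (updv r k b n).
    move=> n fn; rewrite /updv eqn_add2l; case: eqP => // nk.
    by apply: er; split=> // kn; apply: nk.
  have v16 : 16 < 17 + k by rewrite (leq_trans _ (leq_addr k 17)).
  have dx (x : G) : holds (updv e (17 + k) x) (domF (17 + k)) <-> exists b, code b = x.
    by rewrite (holds_domF v16 (eP' x)) /updv eqxx.
  split=> [h x|h x dxx].
    apply/(IH _ _ (eP' _) (er' x)); apply: (h (code x)).
    by apply/(dx (code x)); exists x.
  have [b xE] := iffLR (dx x) dxx; subst x.
  by apply/(IH _ _ (eP' _) (er' b)); exact: h.
Qed.

End Correctness.
End GroupFormulas.

(** * Distinguishing End V from its opposite *)

Section Orientation.
Variable B : pzRingType.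

(* In the opposite of End V, with V the sum of copies V_n of itself, take for sg
   and ta the shifts, for x0 and y0 the embedding of V_0 and the projection onto
   it, and for D the comultiplication below: then x ranges over the embeddings
   of the V_n, so that by the choice of h the chain can be any given sequence,
   in particular that of the powers of t. *)
Definition chain (h sg ta x0 y0 D z : B) : Prop :=
  exists x, [/\ z = x * h, x * x = x * D, x <> 0 &
    forall f g, g * sg = sg * g -> g * ta = ta * g -> x0 * g * y0 = f ->
      f * x = x * g].

(* In End V, p is a projection on a basis line and t is locally nilpotent with a
   right inverse; the last clause holds since Z contains the powers of t and
   the image of u p is finitely generated. Read in the opposite of End V, it
   would yield for every u some n with p u t^n = 0. *)
Definition oriented : Prop := exists p t s : B,
  [/\ p <> 0, t * s = 1,
    forall m, (forall u, exists v, u * p = m * v * p) -> exists m', m * m' = 1 &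
    forall h sg ta x0 y0 D, let Z := chain h sg ta x0 y0 D in
      Z 1 -> (forall z, Z z -> Z (z * t)) -> forall u, exists z, Z z /\ z * u * p = 0].
End Orientation.

Section OrientedFormula.
Local Notation V := (@Var ring_language).
Local Notation "t =~ u" := (@Equal ring_language t u) (at level 70).
Local Notation "t ** u" := (rmul t u) (at level 40, left associativity).
Local Notation "a ==>> b" := (Defs.Implies a b) (at level 75, right associativity).

Definition chainF (z : term ring_language) : formula ring_language :=
  FEx 14 (FAnd (z =~ (V 14 ** V 7))
    (FAnd (V 14 ** V 14 =~ V 14 ** V 12)
    (FAnd (FNot (V 14 =~ rzero))
    (Forall 15 (Forall 16 (V 16 ** V 8 =~ V 8 ** V 16 ==>>
       V 16 ** V 9 =~ V 9 ** V 16 ==>> (V 10 ** V 16 ** V 11) =~ V 15 ==>>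
       V 15 ** V 14 =~ V 14 ** V 16)))))).

Definition cogeneratesF : formula ring_language :=
  Forall 3 (Forall 4 (FEx 5 (V 4 ** V 0 =~ V 3 ** V 5 ** V 0)) ==>>
            FEx 6 (V 3 ** V 6 =~ rone)).

Definition nilpotentF : formula ring_language :=
  Forall 7 (Forall 8 (Forall 9 (Forall 10 (Forall 11 (Forall 12
    (chainF rone ==>> Forall 13 (chainF (V 13) ==>> chainF (V 13 ** V 1)) ==>>
     Forall 4 (FEx 13 (FAnd (chainF (V 13)) (V 13 ** V 4 ** V 0 =~ rzero))))))))).

Definition orientedF : formula ring_language :=
  FEx 0 (FEx 1 (FEx 2 (FAnd (FNot (V 0 =~ rzero))
    (FAnd (V 1 ** V 2 =~ rone) (FAnd cogeneratesF nilpotentF))))).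

Variables (B : pzRingType).
Implicit Type r : nat -> ring_model B.

Lemma holds_chainF r z (b : B) : (forall x : B, eval (updv r 14 x) z = b) ->
  holds r (chainF z) <-> chain (r 7%N : B) (r 8%N) (r 9%N) (r 10%N) (r 11%N) (r 12%N) b.
Proof.
move=> zE; rewrite holds_ex; split.
  case=> x; rewrite !holds_and => -[h1 [h2 [h3 h4]]]; exists x; split.
  - by rewrite -(zE x).
  - exact: h2.
  - exact: h3.
  - by move=> f g; exact: (h4 f g).
case=> x [h1 h2 h3 h4]; exists x; rewrite !holds_and; split; first by rewrite /= zE.
by split; [exact: h2 | split; [exact: h3 | move=> f g; exact: (h4 f g)]].
Qed.

Lemma holds_cogeneratesF r (p : B) : r 0%N = p -> holds r cogeneratesF <->
  (forall m, (forall u, exists v, u * p = m * v * p) -> exists m', m * m' = 1).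
Proof.
move=> <-.
have exE r1 k phi : holds r1 (FEx k phi) <-> exists x : ring_model B, holds (updv r1 k x) phi.
  exact: holds_ex.
split=> H m hm.
  have [|m' hm'] := iffLR (exE (updv r 3 m) 6 (V 3 ** V 6 =~ rone)) (H m _).
    move=> u; have [v hv] := hm u.
    by apply: (iffRL (exE (updv (updv r 3 m) 4 u) 5
      (V 4 ** V 0 =~ V 3 ** V 5 ** V 0))); exists v.
  by exists m'.
apply: (iffRL (exE (updv r 3 m) 6 (V 3 ** V 6 =~ rone))).
have [|m' hm'] := H m; last by exists m'.
move=> u; have [v hv] := iffLR (exE (updv (updv r 3 m) 4 u) 5
  (V 4 ** V 0 =~ V 3 ** V 5 ** V 0)) (hm u).
by exists v.
Qed.

Lemma holds_nilpotentF r (p t : B) : r 0%N = p -> r 1%N = t ->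
  holds r nilpotentF <->
  (forall h sg ta x0 y0 D, let Z := chain h sg ta x0 y0 D in
      Z 1 -> (forall z, Z z -> Z (z * t)) -> forall u, exists z, Z z /\ z * u * p = 0).
Proof.
move=> <- <-; split=> H h sg ta x0 y0 D; have {}H := H h sg ta x0 y0 D;
  pose r' : nat -> ring_model B :=
    updv (updv (updv (updv (updv (updv r 7 h) 8 sg) 9 ta) 10 x0) 11 y0) 12 D.
  move=> Z Z1 Zt u.
  have [||z] := iffLR (@holds_ex _ (ring_model B) (updv r' 4 u) 13
    (FAnd (chainF (V 13)) (V 13 ** V 4 ** V 0 =~ rzero))) (H _ _ u).
  - by apply: (iffRL (@holds_chainF r' rone 1 _)).
  - move=> z hz.
    apply: (iffRL (@holds_chainF (updv r' 13 z) (V 13 ** V 1) (z * r 1%N) _)) => //.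
    by apply: Zt; apply: (iffLR (@holds_chainF (updv r' 13 z) (V 13) z _)).
  rewrite holds_and => -[hz z0]; exists z; split=> //.
  by apply: (iffLR (@holds_chainF (updv (updv r' 4 u) 13 z) (V 13) z _)).
move=> Z1 Zt u; apply: (iffRL (@holds_ex _ (ring_model B) (updv r' 4 u) 13
    (FAnd (chainF (V 13)) (V 13 ** V 4 ** V 0 =~ rzero)))).
have [||z [hz z0]] := H _ _ u.
- by apply: (iffLR (@holds_chainF r' rone 1 _)).
- move=> z hz; apply: (iffLR (@holds_chainF (updv r' 13 z) (V 13 ** V 1) (z * r 1%N) _)) => //.
  by apply: Zt; apply: (iffRL (@holds_chainF (updv r' 13 z) (V 13) z _)).
exists z; rewrite holds_and; split=> //.
by apply: (iffRL (@holds_chainF (updv (updv r' 4 u) 13 z) (V 13) z _)).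
Qed.

Lemma holds_orientedF r : holds r orientedF <-> oriented B.
Proof.
rewrite /orientedF holds_ex; split=> -[p].
  rewrite holds_ex => -[t]; rewrite holds_ex => -[s].
  rewrite !holds_and (@holds_cogeneratesF _ p) // (@holds_nilpotentF _ p t) //.
  by case=> h1 [h2 [h3 h4]]; exists p, t, s; split.
case=> t [s [h1 h2 h3 h4]].
exists p; rewrite holds_ex; exists t; rewrite holds_ex; exists s.
by rewrite !holds_and (@holds_cogeneratesF _ p) // (@holds_nilpotentF _ p t).
Qed.
End OrientedFormula.

(** * Transfer between rings and unit groups *)

Section UnitsInRing.
Local Notation V := (@Var ring_language).

(* A group variable n becomes the pair of ring variables 2n, 2n+1, standing for
   a unit and its inverse. *)
Fixpoint utr (t : term group_language) : term ring_language * term ring_language :=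
  match t with
  | Var n => (V n.*2, V n.*2.+1)
  | App s args =>
      match s return ('I_(@arity group_language s) ->
                      term ring_language * term ring_language) ->
                     term ring_language * term ring_language with
      | GOne => fun=> (rone, rone)
      | GInv => fun a => ((a ord0).2, (a ord0).1)
      | GMul => fun a =>
          (rmul (a ord0).1 (a ord_max).1, rmul (a ord_max).2 (a ord0).2)
      end (fun i => utr (args i))
  end.

Fixpoint utrf (phi : formula group_language) : formula ring_language :=
  match phi with
  | Equal t u => @Equal ring_language (utr t).1 (utr u).1
  | Falsum => Falsum
  | Defs.Implies a b => Defs.Implies (utrf a) (utrf b)
  | Forall k a => Forall k.*2 (Forall k.*2.+1
      (Defs.Implies (@Equal ring_language (rmul (V k.*2) (V k.*2.+1)) rone)
      (Defs.Implies (@Equal ring_language (rmul (V k.*2.+1) (V k.*2)) rone)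
        (utrf a))))
  end.

Variables (A : pzRingType) (G : groupType) (iota : G -> A).
Hypothesis iotaP : unit_embedding iota.

Lemma utr_correct (e : nat -> ring_model A) (r : nat -> group_model G) t :
  (forall n, occurs n t ->
     e n.*2 = iota (r n) /\ e n.*2.+1 = iota (r n : G)^-1%g) ->
  eval e (utr t).1 = iota (eval r t) /\
  eval e (utr t).2 = iota (eval r t : G)^-1%g.
Proof.
elim: t => [n|s args IH] er; first exact: er.
have {}IH i : eval e (utr (args i)).1 = iota (eval r (args i)) /\
    eval e (utr (args i)).2 = iota (eval r (args i) : G)^-1%g.
  by apply: IH => n oc; apply: er; exists i.
case: s args IH er => args IH er /=.
- by rewrite invg1 (ue1 iotaP).
- by have [-> ->] := IH ord0; rewrite invgK.
- have [-> ->] := IH ord0; have [-> ->] := IH ord_max.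
  by rewrite invgM !(ueM iotaP).
Qed.

Lemma utrf_correct phi : forall (e : nat -> ring_model A) (r : nat -> group_model G),
  (forall n, free_in n phi ->
     e n.*2 = iota (r n) /\ e n.*2.+1 = iota (r n : G)^-1%g) ->
  holds e (utrf phi) <-> holds r phi.
Proof.
elim: phi => [t u|//|a IHa b IHb|k a IH] e r er.
- have [t1 _] := @utr_correct e r t (fun n oc => er n (or_introl oc)).
  have [u1 _] := @utr_correct e r u (fun n oc => er n (or_intror oc)).
  by rewrite /= t1 u1; split=> [/(ue_inj iotaP)|->].
- by rewrite /= (IHa e r) ?(IHb e r) // => n fn; apply: er; [right|left].
have er' g : forall n, free_in n a ->
    updv (updv e k.*2 (iota g)) k.*2.+1 (iota g^-1%g) n.*2 = iota (updv r k g n) /\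
    updv (updv e k.*2 (iota g)) k.*2.+1 (iota g^-1%g) n.*2.+1 =
      iota (updv r k g n : G)^-1%g.
  move=> n fn; rewrite /updv.
  have -> : (n.*2 == k.*2.+1) = false.
    by apply/eqP => /(congr1 odd); rewrite /= !odd_double.
  have -> : (n.*2.+1 == k.*2) = false.
    by apply/eqP => /(congr1 odd); rewrite /= !odd_double.
  rewrite eqSS (inj_eq double_inj); case: eqP => // nk.
  by apply: er; split=> // kn; apply: nk.
have E1 (a1 a2 : A) : updv (updv e k.*2 a1) k.*2.+1 a2 k.*2 = a1.
  rewrite /updv eqxx; case: eqP => // /(congr1 odd).
  by rewrite /= !odd_double.
have E2 (a1 a2 : A) : updv (updv e k.*2 a1) k.*2.+1 a2 k.*2.+1 = a2.
  by rewrite /updv eqxx.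
have P12 (a1 a2 : A) : (updv (updv e k.*2 a1) k.*2.+1 a2 k.*2 : A) *
  updv (updv e k.*2 a1) k.*2.+1 a2 k.*2.+1 = a1 * a2 by rewrite E1 E2.
have P21 (a1 a2 : A) : (updv (updv e k.*2 a1) k.*2.+1 a2 k.*2.+1 : A) *
  updv (updv e k.*2 a1) k.*2.+1 a2 k.*2 = a2 * a1 by rewrite E1 E2.
split=> [h g|h a1 a2 h12 h21].
  apply/(IH _ _ (er' g)); apply: (h (iota g) (iota g^-1%g)).
    exact: (etrans (P12 _ _) (ueV iotaP g)).
  exact: (etrans (P21 _ _) (ueVl iotaP g)).
have h12' : a1 * a2 = 1 := etrans (esym (P12 a1 a2)) h12.
have h21' : a2 * a1 = 1 := etrans (esym (P21 a1 a2)) h21.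
have [g gE] := ue_surj iotaP h12' h21'; subst a1.
have aE := ueV_uniq iotaP h12'; subst a2.
by apply/(IH _ _ (er' g)); exact: h.
Qed.

Lemma satisfies_utrf phi : sentence phi ->
  satisfies (ring_model A) (utrf phi) <-> satisfies (group_model G) phi.
Proof.
move=> sp; split=> h e.
  apply/(@utrf_correct phi (fun=> (0 : A)) e); last exact: h.
  by move=> n /sp.
by apply/(@utrf_correct phi e (fun=> (1%g : G))); [move=> n /sp | exact: h].
Qed.
End UnitsInRing.

Lemma ring_to_group_elem_equiv (A A' : pzRingType) (G G' : groupType)
    (iota : G -> A) (iota' : G' -> A') :
  unit_embedding iota -> unit_embedding iota' ->
  ring_elem_equiv A A' -> group_elem_equiv G G'.
Proof.
move=> iP iP' /elem_equiv_satisfies AA' phi sp.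
by rewrite -(satisfies_utrf iP sp) -(satisfies_utrf iP' sp).
Qed.

Section RingInUnits.
Variables (A : pzRingType) (G : groupType) (iota : G -> A).
Hypothesis iotaP : unit_embedding iota.
Hypothesis halfA : contains_half A.
Hypothesis connA : no_nontrivial_central_idempotent A.
Hypothesis neq10 : (1 : A) <> 0.
Variables s0 s1 t0 t1 : A.
Hypothesis sd : self_double s0 s1 t0 t1.
Hypothesis orA : oriented A.
Hypothesis norA : ~ oriented A^c.

(* psi discards the parameters that code the opposite ring. *)
Lemma satisfies_trf (psi phi : formula ring_language) :
  (forall B : pzRingType, satisfies (ring_model B) psi <-> oriented B) ->
  sentence psi -> sentence phi ->
  satisfies (group_model G)
    (Defs.Implies good_formula (Defs.Implies (trf psi) (trf phi))) <->
  satisfies (ring_model A) phi.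
Proof.
move=> psiP spsi sphi.
have centerA := commutes_with_units sd iotaP.
have key (B : pzRingType) (code : B -> G) (e : nat -> group_model G) chi :
    sentence chi ->
    coding (sqy (p_y e) o0 o2) (sqy (p_y e) o2 o1) (sqy (p_y e) o1 o0)
      (p_eps e o1) (p_eps e o2) code ->
    (holds e (trf chi) <-> satisfies (ring_model B) chi).
  move=> schi codeP; rewrite (@satisfies_sentence _ (ring_model B) chi (fun=> (0 : B)) schi).
  by apply: (trf_correct codeP) => // n /schi.
split=> [h|h e].
  have [m [p [q [eps [y [gd [code codeP]]]]]]] :=
    good_exists sd iotaP halfA connA neq10.
  (* Slots 6, 10 and 14 hold the [y i i], on which [good] puts no condition. *)
  pose e : nat -> group_model G := nth (1%g : G) [:: m; p; q; eps o0; eps o1; eps o2;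
    y o0 o0; y o0 o1; y o0 o2; y o1 o0; y o1 o1; y o1 o2; y o2 o0; y o2 o1; y o2 o2].
  have epsE : p_eps e = eps by apply/funext => i; case: (ord3P i) => ->.
  have yE : p_y e = y.
    apply/funext => i; apply/funext => j.
    by case: (ord3P i) (ord3P j) => -> [] ->.
  have ge : holds e good_formula by apply/holds_good; rewrite epsE yE.
  rewrite -{}epsE -{}yE in codeP.
  by apply/(key _ _ _ _ sphi codeP); apply: (h e ge); apply/(key _ _ _ _ spsi codeP)/psiP.
move=> /holds_good gd.
have [[code codeP]|[code codeP]] := good_coding halfA connA iotaP centerA gd.
  by move=> _; apply/(key _ _ _ _ sphi codeP).
by move=> /(key _ _ _ _ spsi codeP)/psiP.
Qed.
End RingInUnits.

Lemma oriented_sentence : exists psi : formula ring_language, sentence psi /\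
  forall B : pzRingType, satisfies (ring_model B) psi <-> oriented B.
Proof.
have [N Nb] := free_bounded orientedF.
exists (univ_closure N orientedF); split.
  by move=> n /free_in_closure[/Nb]; rewrite ltnNge => /negP.
move=> B; rewrite satisfies_closure; split=> [/(_ (fun=> (0 : B)))|h e].
  by move/holds_orientedF.
exact/holds_orientedF.
Qed.

(** * Endomorphisms of a free module of infinite rank *)

Section Cardinality.
Local Open Scope classical_set_scope.

Lemma infinite_seq (T : choiceType) (U : set T) : infinite_set U ->
  exists g : nat -> T, injective g /\ forall n, U (g n).
Proof.
move=> Uinf; have [u Uu] := infinite_setN0 Uinf.
have /infiniteP/card_leP[f] := Uinf.
exists (fun n => set_val (f (SigSub (in_setT n)))); split=> [m n|n].
  move=> /val_inj/(inj (x:=SigSub (in_setT m)) (y := SigSub (in_setT n))).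
  by move=> H; have /(congr1 set_val) := H (in_setT _) (in_setT _).
exact: set_valP.
Qed.

(* C is a maximal family of disjoint sequences, which misses only finitely many
   indices. *)
Lemma infinite_times_nat_inj (I : choiceType) : infinite_set [set: I] ->
  exists j : I * nat -> I, injective j.
Proof.
move=> Iinf; pose rg (s : nat -> I) : set I := range s.
have [C [CB Ctriv Cmax]] := @ex_maximal_disjoint_subcollection _ _ rg [set s | injective s].
pose U : set I := [set i | forall s, C s -> ~ rg s i].
have Ufin : finite_set U.
  apply: contrapT => /infinite_seq[g [ginj gU]].
  have gC : ~ C g by move=> Cg; apply: (gU 0%N g Cg); exists 0%N.
  apply: (Cmax (C `|` [set g])).
  - split; first by move=> s Cs; left.
    by move=> /(_ g (or_intror erefl)).
  - by move=> s [/CB|->].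
  - move=> s s' [Cs|->] [Cs'|->] [i [si s'i]] //; first by apply: Ctriv => //; exists i.
      by case: s'i => n _ gi; subst i; case: (gU n _ Cs).
    by case: si => n _ gi; subst i; case: (gU n _ Cs').
have [s0 Cs0] : exists s0, C s0.
  apply: contrapT => nC; apply: Iinf; apply: sub_finite_set Ufin.
  by move=> i _ s Cs; case: nC; exists s.
have /countable_injP[u uinj] := finite_set_countable Ufin.
(* Each index goes to a member of C and a number: an odd one for its position on its own sequence,
   or an even one on the fixed sequence [s0] for the finitely many indices missed by all. *)
have /choice[k kP] : forall i, exists k : (nat -> I) * nat, C k.1 /\
    ((U i /\ k = (s0, (u i).*2)) \/ (~ U i /\ exists n, k.2 = n.*2.+1 /\ k.1 n = i)).
  move=> i; have [Ui|nUi] := EM (U i); first by exists (s0, (u i).*2); split=> //; left.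
  have [s [Cs [n _ sn]]] : exists s, C s /\ rg s i.
    apply: contrapT => H; apply: nUi => s Cs si; apply: H; by exists s.
  by exists (s, n.*2.+1); split=> //; right; split=> //; exists n.
have kinj : injective k.
  move=> i i' kk; have [_ hi] := kP i; have [_ hi'] := kP i'.
  move: hi hi'; rewrite -kk => -[[Ui ->]|[_ [n [k2 k1]]]] [[Ui' E]|[_ [n' [k2' k1']]]].
  - case: E => /double_inj; exact: (uinj _ _ (mem_set Ui) (mem_set Ui')).
  - by move: k2' => /(congr1 odd); rewrite /= !odd_double.
  - by move: k2; rewrite E => /(congr1 odd); rewrite /= !odd_double.
  - by move: k2; rewrite k2' => -[/double_inj nn]; rewrite -k1 -k1' nn.
(* Each sequence is a copy of nat, hence of nat * nat, which leaves room for the additional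
   coordinate. *)
exists (fun x => (k x.1).1 (pickle ((k x.1).2, x.2))).
move=> [i n] [i' n'] /= E.
have [Ci _] := kP i; have [Ci' _] := kP i'.
have s12 : (k i).1 = (k i').1.
  apply: Ctriv => //; exists ((k i).1 (pickle ((k i).2, n))).
  by split; [exists (pickle ((k i).2, n)) | rewrite E; exists (pickle ((k i').2, n'))].
rewrite -s12 in E; have /(pcan_inj pickleK)[k2 ->] := CB _ Ci _ _ E.
congr (_, _); apply: kinj; move: s12 k2.
by case: (k i) (k i') => ? ? [? ?] /= -> ->.
Qed.

Lemma injective_card_le (T U : Type) (f : T -> U) : injective f ->
  ([set: T] #<= [set: U])%card.
Proof.
move=> finj; have /Pinj[h _] : {in [set: T] &, injective f} by move=> x y _ _ /finj.
have /injPfun[i _] : {homo h : x / [set: T] x >-> [set: U] x} by [].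
exact: (inj_card_le i).
Qed.

(** A bijection of I with I times nat, in coordinates. Here [se i] is the level of i; the basis
    vectors of one level span one of countably many copies of V. *)
Lemma infinite_times_nat (I : choiceType) : infinite_set [set: I] ->
  exists (pr : I -> nat -> I) (fi : I -> I) (se : I -> nat),
  [/\ forall i, pr (fi i) (se i) = i, forall i n, fi (pr i n) = i &
      forall i n, se (pr i n) = n].
Proof.
move=> /infinite_times_nat_inj[j jinj].
have /card_bijP[f [g fK gK]] : ([set: (I * nat)%type] #= [set: I])%card.
  apply: Cantor_Bernstein; first exact: injective_card_le jinj.
  by apply: (@injective_card_le _ _ (fun i => (i, 0%N))) => i i' [].
pose F x := set_val (f (SigSub (in_setT x))).
pose G i := set_val (g (SigSub (in_setT i))).
have FG i : F (G i) = i.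
  rewrite /F; have -> : SigSub (in_setT (G i)) = g (SigSub (in_setT i)) by apply: val_inj.
  by rewrite gK.
have GF x : G (F x) = x.
  rewrite /G; have -> : SigSub (in_setT (F x)) = f (SigSub (in_setT x)) by apply: val_inj.
  by rewrite fK.
exists (fun i n => F (i, n)), (fun i => (G i).1), (fun i => (G i).2).
by split=> [i|i n|i n]; rewrite ?GF // -surjective_pairing FG.
Qed.

End Cardinality.

Section EndLemmas.
Variables (R : pzRingType) (V : lmodType R).
Implicit Types f g : End V.
Lemma EndD f u v : f (u + v) = f u + f v.
Proof. exact: (raddfD (f : {linear V -> V})). Qed.
Lemma End0 f : f 0 = 0.
Proof. exact: (raddf0 (f : {linear V -> V})). Qed.
Lemma EndZ f a u : f (a *: u) = a *: f u.
Proof. exact: (linearZZ (f : {linear V -> V})). Qed.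
Lemma End_sum f (I : Type) (s : seq I) (F : I -> V) :
  f (\sum_(i <- s) F i) = \sum_(i <- s) f (F i).
Proof. exact: (raddf_sum (f : {linear V -> V})). Qed.
Lemma EndME f g v : End_fun (f * g) v = f (g v). Proof. by []. Qed.
Lemma EndDE f g v : End_fun (f + g) v = f v + g v. Proof. by []. Qed.
End EndLemmas.

(** * Bases, finite supports and the ring of endomorphisms *)

Section FreeModule.
Variables (R : pzRingType) (V : lmodType R) (I : choiceType) (b : I -> V).
Hypothesis bP : is_basis b.

(** This makes the extension of a map from the basis independent of the chosen expansions. The list
    may repeat indices, so coefficients are collected before linear independence is used. *)
Lemma basis_relation (l : seq (R * I)) (W : lmodType R) (F : I -> W) :
  \sum_(x <- l) x.1 *: b x.2 = 0 -> \sum_(x <- l) x.1 *: F x.2 = 0.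
Proof.
pose s := undup [seq x.2 | x <- l]; pose c i := \sum_(x <- l | x.2 == i) x.1.
have E (W' : lmodType R) (H : I -> W') :
    \sum_(x <- l) x.1 *: H x.2 = \sum_(i <- s) c i *: H i.
  transitivity (\sum_(i <- s) \sum_(x <- l | x.2 == i) x.1 *: H x.2); last first.
    apply: eq_bigr => i _; rewrite scaler_suml; apply: eq_bigr => x /eqP -> //.
  rewrite (exchange_big_dep xpredT) //= big_seq [RHS]big_seq; apply: eq_bigr => x xl.
  rewrite big_mkcond (bigD1_seq x.2) ?undup_uniq ?mem_undup ?map_f //= eqxx.
  by rewrite big1 ?addr0 // => i ix; rewrite eq_sym (negbTE ix).
rewrite !E => /(bP.2 _ _ (undup_uniq _)) c0.
by rewrite big_seq big1 // => i /c0 ->; rewrite scale0r.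
Qed.

Lemma basis_span v : exists l : seq (R * I), v = \sum_(x <- l) x.1 *: b x.2.
Proof.
have [s [c ->]] := bP.1 v; exists [seq (c i, i) | i <- s].
by rewrite big_map.
Qed.

Lemma ext_exists (F : I -> V) : exists f : End V, forall i, f (b i) = F i.
Proof.
have /choice[rep repE] := basis_span.
pose g v := \sum_(x <- rep v) x.1 *: F x.2.
have gE l v : v = \sum_(x <- l) x.1 *: b x.2 -> g v = \sum_(x <- l) x.1 *: F x.2.
  move=> vE; apply/eqP; rewrite -subr_eq0; apply/eqP.
  have neg (W : lmodType R) (H : I -> W) :
      \sum_(x <- rep v) x.1 *: H x.2 - \sum_(x <- l) x.1 *: H x.2 =
      \sum_(x <- rep v ++ [seq (- x.1, x.2) | x <- l]) x.1 *: H x.2.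
    rewrite big_cat big_map /=; congr (_ + _); rewrite -sumrN.
    by apply: eq_bigr => x _; rewrite scaleNr.
  by rewrite neg; apply: basis_relation; rewrite -neg -vE -repE subrr.
have glin : linear g.
  move=> a u v.
  rewrite (gE ([seq (a * x.1, x.2) | x <- rep u] ++ rep v)).
    rewrite big_cat big_map /= scaler_sumr; congr (_ + _).
    by apply: eq_bigr => x _; rewrite scalerA.
  rewrite big_cat big_map /= -repE; congr (_ + _); rewrite {1}(repE u) scaler_sumr.
  by apply: eq_bigr => x _; rewrite scalerA.
pose f : {linear V -> V} := HB.pack g (GRing.isLinear.Build R V V *:%R g glin).
exists f => i.
rewrite /End_fun /= (gE [:: (1, i)]) ?big_seq1 /= ?scale1r //.
Qed.

Definition ext (F : I -> V) : End V := sval (cid (ext_exists F)).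
Lemma extE F i : ext F (b i) = F i.
Proof. by rewrite /ext; case: cid. Qed.

Lemma End_eq_basis (f g : End V) : (forall i, f (b i) = g (b i)) -> f = g.
Proof.
move=> fg; apply: End_ext => v; have [s [c ->]] := bP.1 v.
by rewrite !End_sum; apply: eq_bigr => i _; rewrite !EndZ fg.
Qed.

Definition bproj (S : seq I) : End V := ext (fun i => if i \in S then b i else 0).

Lemma bproj_support v : exists S, bproj S v = v.
Proof.
have [s [c ->]] := bP.1 v; exists s.
rewrite End_sum big_seq [RHS]big_seq; apply: eq_bigr => i si.
by rewrite EndZ /bproj extE si.
Qed.

Lemma bproj_mono (S S' : seq I) v : {subset S <= S'} -> bproj S v = v -> bproj S' v = v.
Proof.
move=> SS' <-.
suff E : bproj S' * bproj S = bproj S by rewrite -[LHS]/(End_fun (bproj S' * bproj S) v) E.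
apply: End_eq_basis => i.
rewrite EndME /bproj !extE; case: ifP => [iS|_]; last by rewrite End0.
by rewrite extE SS'.
Qed.

Hypothesis R10 : (1 : R) <> 0.

Lemma basis_coef0 a i : a *: b i = 0 -> a = 0.
Proof.
move=> ab; apply: (bP.2 [:: i] (fun=> a) isT _ i (mem_head _ _)).
by rewrite big_seq1.
Qed.

Lemma basis_neq0 i : b i <> 0.
Proof. by move=> bi; apply: R10; apply: (@basis_coef0 _ i); rewrite scale1r. Qed.

Variables (pr : I -> nat -> I) (fi : I -> I) (se : I -> nat).
Hypotheses (prK : forall i, pr (fi i) (se i) = i) (fiK : forall i n, fi (pr i n) = i).
Hypothesis seK : forall i n, se (pr i n) = n.
Variable i0 : I.

Lemma notin_finite (S : seq I) : exists j, j \notin S.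
Proof.
apply: contrapT => H.
have sub : {subset [seq pr i0 n | n <- iota 0 (size S).+1] <= S}.
  by move=> j _; apply: contrapT => /negP jS; apply: H; exists j.
have uq : uniq [seq pr i0 n | n <- iota 0 (size S).+1].
  rewrite map_inj_uniq ?iota_uniq // => n m /(congr1 se).
  by rewrite !seK.
by have := uniq_leq_size uq sub; rewrite size_map size_iota ltnn.
Qed.

(** Even levels form one copy of V and odd levels another. *)
Lemma End_self_double : exists s0 s1 t0 t1 : End V, self_double s0 s1 t0 t1.
Proof.
exists (ext (fun i => b (pr (fi i) (se i).*2))), (ext (fun i => b (pr (fi i) (se i).*2.+1))),
  (ext (fun i => if odd (se i) then 0 else b (pr (fi i) (se i)./2))),
  (ext (fun i => if odd (se i) then b (pr (fi i) (se i)./2) else 0)).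
split; apply: End_eq_basis => i; rewrite ?EndDE !EndME !extE ?fiK ?seK /= ?odd_double
  ?doubleK ?uphalf_double ?prK //.
have := odd_double_half (se i); case: (odd (se i)) => /= E; rewrite !End0 !extE !fiK !seK.
  by rewrite add0r; congr b; rewrite -[RHS]prK; congr pr.
by rewrite addr0; congr b; rewrite -[RHS]prK; congr pr.
Qed.

Definition rank1 : End V := ext (fun i => if i == i0 then b i0 else 0).

Lemma rank1_image v : exists a, rank1 v = a *: b i0.
Proof.
have [s [c ->]] := bP.1 v; rewrite End_sum.
apply: (big_ind (fun u : V => exists a : R, u = a *: b i0)).
- by exists 0; rewrite scale0r.
- by move=> _ _ [a ->] [a' ->]; exists (a + a'); rewrite scalerDl.
- move=> i _; rewrite EndZ /rank1 extE; case: eqP => _; first by exists (c i).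
  by exists 0; rewrite scaler0 scale0r.
Qed.

(** A central e commutes with [rank1], so it multiplies [b i0] by some scalar r. Commuting with maps
    that send [b i0] to any given vector, it multiplies every basis vector by r, and r is itself
    central and idempotent. *)
Lemma End_connected : no_nontrivial_central_idempotent R ->
  no_nontrivial_central_idempotent (End V).
Proof.
move=> connR; suff H (e : End V) : e * e = e -> (forall x, GRing.comm e x) ->
  e = 0 \/ e = 1 by [].
move=> ee eC.
have comm (f : End V) v : e (f v) = f (e v).
  by rewrite -[LHS]/(End_fun (e * f) v) eC.
have [r er] : exists r, e (b i0) = r *: b i0.
  have [r rE] := rank1_image (e (b i0)); exists r.
  by rewrite -rE -comm /rank1 extE eqxx.
have ej j : e (b j) = r *: b j.
  by rewrite -[b j](extE (fun=> b j) i0) comm er EndZ extE.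
have [||r0|r1] := connR r.
- apply/eqP; rewrite -subr_eq0; apply/eqP; apply: (@basis_coef0 _ i0).
  by rewrite scalerBl -scalerA -er -EndZ -er -[e (e _)]/(End_fun (e * e) _) ee subrr.
- move=> a; apply/eqP; rewrite -subr_eq0; apply/eqP; apply: (@basis_coef0 _ i0).
  rewrite scalerBl -!scalerA -er -EndZ.
  by rewrite -[in X in _ - X](extE (fun=> a *: b i0) i0) comm er EndZ extE subrr.
- by left; apply: End_eq_basis => j; rewrite ej r0 scale0r.
- by right; apply: End_eq_basis => j; rewrite ej r1 scale1r.
Qed.

Definition back : End V := ext (fun i => if se i is n.+1 then b (pr (fi i) n) else 0).
Definition forth : End V := ext (fun i => b (pr (fi i) (se i).+1)).

Lemma back_forth : back * forth = 1.
Proof.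
by apply: End_eq_basis => i; rewrite EndME /back /forth !extE seK fiK prK.
Qed.

Lemma back_pow n i : (iter n (fun z : End V => z * back) 1) (b i) =
  if (n <= se i)%N then b (pr (fi i) (se i - n)) else 0.
Proof.
elim: n i => [|n IH] i; first by rewrite subn0 prK.
rewrite iterS EndME /back extE; case E : (se i) => [|k]; first by rewrite End0.
by rewrite IH seK fiK ltnS subSS.
Qed.

Lemma End_oriented : oriented (End V).
Proof.
exists rank1, back, forth; split.
- move=> p0; apply: (@basis_neq0 i0).
  have r1 : rank1 (b i0) = b i0 by rewrite /rank1 extE eqxx.
  by rewrite -r1 p0.
- exact: back_forth.
(* With u constant on the basis with value [b i], the hypothesis puts [b i] in the image of m;
   preimages of the basis vectors extend to a right inverse. *)
- move=> m H.
  have /choice[c cE] : forall i, exists c, m c = b i.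
    move=> i; have [v vE] := H (ext (fun=> b i)); exists (v (b i0)).
    have := congr1 (fun f : End V => f (b i0)) vE.
    by rewrite !EndME /rank1 !extE eqxx extE => ->.
  by exists (ext c); apply: End_eq_basis => i; rewrite EndME extE; exact: cE.
move=> h sg ta x0 y0 D Z Z1 Zt u.
have Zn n : Z (iter n (fun z : End V => z * back) 1).
  by elim: n => [//|n IH]; rewrite iterS; apply: Zt.
have [S SE] := bproj_support (End_fun u (b i0)).
(* [back] lowers levels by one, so its n-th power kills [u (b i0)] once n exceeds all levels in the
   finite support of that vector. *)
have [n nP] : exists n, forall j, j \in S -> (se j < n)%N.
  exists (\max_(i <- S) se i).+1 => j jS; rewrite ltnS.
  exact: (leq_bigmax_seq _ jS).
exists (iter n (fun z : End V => z * back) 1); split=> //.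
apply: End_eq_basis => i; rewrite !EndME /rank1 extE.
case: eqP => _; last by rewrite !End0.
rewrite -SE -[LHS]/(End_fun (iter n (fun z : End V => z * back) 1 * bproj S) _).
suff -> : iter n (fun z : End V => z * back) 1 * bproj S = 0 by [].
apply: End_eq_basis => j; rewrite EndME /bproj extE; case: ifP => jS; last by rewrite End0.
by rewrite back_pow leqNgt nP.
Qed.

(** * A free module as a sum of countably many copies of itself *)

Definition level n : End V := ext (fun i => b (pr i n)).
Definition colevel n : End V := ext (fun i => if se i == n then b (fi i) else 0).

Lemma level_basis n i : level n (b i) = b (pr i n).
Proof. exact: extE. Qed.

Lemma colevel_level n k : colevel k * level n = if n == k then 1 else 0.
Proof.
apply: End_eq_basis => i; rewrite EndME level_basis /colevel extE seK fiK.
by case: eqP.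
Qed.

Lemma colevel_joint (v : V) : (forall n, colevel n v = 0) -> v = 0.
Proof.
(* [q N] projects onto the levels below N; it kills v for every N, yet fixes v for large N by finite
   support. *)
move=> v0; pose q N := ext (fun i => if (se i < N)%N then b i else 0).
have qv N : q N v = 0.
  elim: N => [|N IH].
    suff -> : q 0%N = 0 by [].
    by apply: End_eq_basis => i; rewrite /q extE.
  have -> : q N.+1 = q N + level N * colevel N.
    apply: End_eq_basis => i; rewrite EndDE EndME /q /colevel !extE ltnS leq_eqVlt.
    case: eqP => [<-|_] /=; last by rewrite End0 addr0.
    by rewrite ltnn add0r level_basis prK.
  by rewrite EndDE IH EndME v0 End0 addr0.
have [S SE] := bproj_support v.
have [N NP] : exists N, forall j, j \in S -> (se j < N)%N.
  exists (\max_(i <- S) se i).+1 => j jS; rewrite ltnS.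
  exact: (leq_bigmax_seq _ jS).
rewrite -(qv N) -{1 2}SE -[RHS]/(End_fun (q N * bproj S) v); congr (End_fun _ v).
apply: End_eq_basis => i; rewrite EndME /bproj !extE; case: ifP => [/NP iN|_].
  by rewrite extE iN.
by rewrite End0.
Qed.

Definition diagonal (f : End V) : End V := ext (fun i => level (se i) (f (b (fi i)))).

Lemma diagonal_level f n : diagonal f * level n = level n * f.
Proof.
by apply: End_eq_basis => i; rewrite !EndME level_basis /diagonal extE seK fiK.
Qed.

Lemma colevel_diagonal f n : colevel n * diagonal f = f * colevel n.
Proof.
apply: End_eq_basis => i; rewrite !EndME /diagonal !extE.
rewrite -[LHS]/(End_fun (colevel n * level (se i)) _) colevel_level.
by case: eqP => _ //; rewrite End0.
Qed.

Lemma forth_level n : forth * level n = level n.+1.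
Proof.
by apply: End_eq_basis => i; rewrite EndME !level_basis /forth extE seK fiK.
Qed.

Lemma back_levelS n : back * level n.+1 = level n.
Proof.
by apply: End_eq_basis => i; rewrite EndME !level_basis /back extE seK fiK.
Qed.

Lemma back_level0 : back * level 0 = 0.
Proof.
by apply: End_eq_basis => i; rewrite EndME !level_basis /back extE seK.
Qed.

Lemma level_ext (f g : End V) : (forall n, f * level n = g * level n) -> f = g.
Proof.
move=> fg; apply: End_eq_basis => i; rewrite -[i]prK -level_basis.
by rewrite -[LHS]/(End_fun (f * level (se i)) _) fg.
Qed.

Lemma diagonal_forth f : diagonal f * forth = forth * diagonal f.
Proof.
apply: level_ext => n; rewrite -!mulrA forth_level !diagonal_level.
by rewrite mulrA forth_level.
Qed.

Lemma diagonal_back f : diagonal f * back = back * diagonal f.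
Proof.
apply: level_ext => -[|n]; rewrite -!mulrA diagonal_level.
  by rewrite back_level0 mulr0 mulrA back_level0 mul0r.
by rewrite back_levelS diagonal_level mulrA back_levelS.
Qed.

Lemma forth_back : forth * back + level 0 * colevel 0 = 1.
Proof.
apply: level_ext => -[|n]; rewrite mulrDl -!mulrA colevel_level /= mul1r.
  by rewrite back_level0 mulr0 add0r mulr1.
by rewrite back_levelS mulr0 addr0 forth_level.
Qed.

(** As g commutes with both shifts, [forth * back] kills [g * level 0], so by [forth_back] the
    zeroth copy is stable under g; [forth] then carries its entry to all levels. *)
Lemma diagonalP (g : End V) n : g * forth = forth * g -> g * back = back * g ->
  level n * (colevel 0 * g * level 0) = g * level n.
Proof.
move=> gf gb; elim: n => [|n IH].
  rewrite !mulrA -[RHS]mul1r -forth_back mulrDl -(mulrA forth) (mulrA back) -gb.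
  by rewrite -(mulrA g) back_level0 !mulr0 add0r !mulrA.
by rewrite -forth_level -mulrA IH !mulrA gf.
Qed.

(* The group-like condition x x = D x, with D x_n = x_n x_n, singles out the
   x_n among the combinations of the x_n with central coefficients. *)
Definition comult : End V := ext (fun i => level (se i) (b i)).

Lemma comult_level n : comult * level n = level n * level n.
Proof.
by apply: End_eq_basis => i; rewrite !EndME level_basis /comult extE seK level_basis.
Qed.

Lemma colevel_comult n : colevel n * comult = level n * colevel n.
Proof.
apply: level_ext => k; rewrite -!mulrA comult_level colevel_level mulrA colevel_level.
by case: eqP => [->|_]; rewrite ?mul1r ?mulr1 ?mul0r ?mulr0.
Qed.

(** The components a_n of x are central, because every f is the (0,0) entry of [diagonal f], which
    commutes with both shifts. The condition on [x * x] makes them orthogonal idempotents, so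
    connectedness leaves exactly one that is nonzero, and it equals 1. *)
Lemma grouplike_level (x : End V) : no_nontrivial_central_idempotent (End V) ->
  x * x = comult * x -> x <> 0 ->
  (forall f g, g * forth = forth * g -> g * back = back * g ->
     colevel 0 * g * level 0 = f -> x * f = g * x) ->
  exists n, x = level n.
Proof.
move=> connE xx x0 xC; pose a n := colevel n * x.
have aC n f : GRing.comm (a n) f.
  have H : x * f = diagonal f * x.
    apply: xC; rewrite ?diagonal_forth ?diagonal_back //.
    by rewrite -mulrA diagonal_level mulrA colevel_level mul1r.
  by rewrite /GRing.comm /a -mulrA H mulrA colevel_diagonal mulrA.
have xa n : level n * a n = a n * x.
  by rewrite /a mulrA -colevel_comult -!mulrA xx.
have aa n k : a n * a k = if n == k then a n else 0.
  rewrite (aC n (a k)) {1}/a -mulrA -(aC n x) -xa mulrA colevel_level.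
  by case: eqP => [->|_]; rewrite ?mul1r ?mul0r.
have xE (y : End V) : (forall n, colevel n * x = colevel n * y) -> x = y.
  move=> xy; apply/eqP; rewrite -subr_eq0; apply/eqP; apply: End_ext => v.
  apply: colevel_joint => n.
  rewrite -[LHS]/(End_fun (colevel n * (x - y)) v) mulrBr xy subrr.
  by [].
have [n an] : exists n, a n <> 0.
  apply: contrapT => H; apply: x0; apply: xE => n; rewrite mulr0.
  by apply: contrapT => an; apply: H; exists n.
have ea : a n * a n = a n by rewrite aa eqxx.
have [//|an1] := connE _ ea (aC n).
exists n; apply: xE => k; rewrite colevel_level -/(a k) eq_sym.
case: eqP => [->//|/eqP kn].
by rewrite -[LHS]mulr1 -an1 aa (negbTE kn).
Qed.

Lemma bproj_common (F : I -> V) (S : seq I) :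
  exists S', forall i, i \in S -> bproj S' (F i) = F i.
Proof.
elim: S => [|i S [S' IH]]; first by exists [::].
have [S'' iS] := bproj_support (F i); exists (S' ++ S'') => j.
rewrite inE => /orP[/eqP->|jS].
  by apply: bproj_mono iS => k kS; rewrite mem_cat kS orbT.
by apply: bproj_mono (IH j jS) => k kS; rewrite mem_cat kS.
Qed.

(** The image of [m' * bproj S] is generated by finitely many vectors, so it lies in the span of a
    finite part S' of the basis, which is not all of V. *)
Lemma not_finitely_generated (S : seq I) (m' m : End V) : m' * (bproj S * m) <> 1.
Proof.
move=> mm; have [S' S'E] := bproj_common (fun i => m' (b i)) S.
have E : bproj S' * (m' * bproj S) = m' * bproj S.
  apply: End_eq_basis => i; rewrite !EndME /bproj !extE; case: ifP => iS.
    exact: S'E.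
  by rewrite !End0.
have p1 : bproj S' = 1 by rewrite -[LHS]mulr1 -mm !mulrA -(mulrA (bproj S')) E -mulrA.
have [j jS] := notin_finite S'; apply: (@basis_neq0 j).
have := congr1 (fun f : End V => End_fun f (b j)) p1.
by rewrite /bproj extE (negbTE jS).
Qed.

(* If every u : V -> V satisfied p u t^n = 0 for some n, a u could be
   constructed against all n at once by prescribing it on larger and larger
   finite sets of basis vectors. *)
Lemma no_uniform_nilpotency (p t s : End V) : p <> 0 -> s * t = 1 ->
  (forall m, (forall u, exists v, p * u = p * (v * m)) -> exists m', m' * m = 1) ->
  ~ forall u, exists n, p * (u * t ^+ n) = 0.
Proof.
move=> p0 st pm H.
have stn n : s ^+ n * t ^+ n = 1.
  elim: n => [|n IH]; first by rewrite !expr0 mulr1.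
  by rewrite exprSr exprS mulrA -(mulrA _ s) st mulr1.
pose good_step n (x y : seq I * End V) :=
  [/\ {subset x.1 <= y.1}, forall i, i \in x.1 -> y.2 (b i) = x.2 (b i) &
      exists v, bproj y.1 (End_fun (t ^+ n) v) = End_fun (t ^+ n) v /\
                End_fun (p * (y.2 * t ^+ n)) v <> 0].
have step n x : exists y, good_step n x y.
  case: x => S w; apply: contrapT => no.
  (* Were there no step, [p * (u * t ^+ n)] would depend only on the values of u on S. Then [pm]
     would make [bproj S * t ^+ n] left invertible, although it factors through a finitely generated
     submodule. *)
  have K (w' : End V) : (forall i, i \in S -> w' (b i) = w (b i)) -> p * (w' * t ^+ n) = 0.
    move=> w'w; apply: End_ext => v; apply: contrapT => pv; apply: no.
    have [S' S'E] := bproj_support (End_fun (t ^+ n) v).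
    exists (S ++ S', w'); split => /=.
    - by move=> i iS; rewrite mem_cat iS.
    - exact: w'w.
    - exists v; split=> //; apply: bproj_mono S'E => i iS.
      by rewrite mem_cat iS orbT.
  have Ku u : p * u * t ^+ n = p * u * (bproj S * t ^+ n).
    have := K (w + u * (1 - bproj S)); rewrite mulrDl mulrDr K // add0r => Hu.
    apply/eqP; rewrite -subr_eq0 !mulrA -mulrBl; apply/eqP; rewrite -[RHS]Hu.
      by rewrite !mulrA mulrBr mulr1.
    move=> i iS; rewrite EndDE EndME.
    suff -> : End_fun (1 - bproj S) (b i) = 0 by rewrite End0 addr0.
    by rewrite -[LHS]/(b i - bproj S (b i)) /bproj extE iS subrr.
  have [u|m' m'E] := pm (bproj S * t ^+ n).
    exists (u * s ^+ n); rewrite [RHS]mulrA -Ku.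
    by rewrite -[RHS]mulrA -(mulrA u) stn mulr1.
  exact: (@not_finitely_generated S m' (t ^+ n)).
have /choice[F FP] : forall nx : nat * (seq I * End V), exists y, good_step nx.1 nx.2 y.
  by move=> [n x]; exact: step.
pose fix sq n : seq I * End V := if n is k.+1 then F (k, sq k) else ([::], 0).
have sqP n : good_step n (sq n) (sq n.+1) := FP (n, sq n).
have later n k i : i \in (sq n).1 ->
    i \in (sq (k + n)%N).1 /\ (sq (k + n)%N).2 (b i) = (sq n).2 (b i).
  move=> iS; elim: k => [|k [IH1 IH2]]; first by [].
  have [sub eqb _] := sqP (k + n)%N; rewrite addSn; split; first exact: sub.
  by rewrite eqb.
have agree n k i : i \in (sq n).1 -> i \in (sq k).1 -> (sq n).2 (b i) = (sq k).2 (b i).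
  wlog nk : n k / (n <= k)%N.
    move=> W; case: (leqP n k) => [|/ltnW] h i1 i2; first exact: W.
    by symmetry; exact: W.
  by move=> /(later n (k - n)%N); rewrite subnK // => -[_ ->].
have /choice[U UE] : forall i, exists x, forall n, i \in (sq n).1 -> x = (sq n).2 (b i).
  move=> i; have [[n iS]|no] := EM (exists n, i \in (sq n).1).
    by exists ((sq n).2 (b i)) => k ik; exact: agree.
  by exists 0 => n iS; case: no; exists n.
have [n pn] := H (ext U).
(* The vector t^n v is supported where the values are fixed at stage n + 1, so the limit map [ext U]
   inherits the nonvanishing found there. *)
have [_ _ [v [vE]]] := sqP n; apply.
rewrite EndME EndME -vE -[(sq n.+1).2 _]/(End_fun ((sq n.+1).2 * bproj (sq n.+1).1) _).
have -> : (sq n.+1).2 * bproj (sq n.+1).1 = ext U * bproj (sq n.+1).1.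
  apply: End_eq_basis => i; rewrite !EndME /bproj extE.
  case: ifP => iS; last by rewrite !End0.
  by rewrite extE (UE i _ iS).
by rewrite EndME vE -[LHS]/(End_fun (p * (ext U * t ^+ n)) v) pn.
Qed.

Lemma End_converse_not_oriented : no_nontrivial_central_idempotent (End V) ->
  ~ oriented (End V)^c.
Proof.
move=> connE [p [t [s [p0 ts pm nil]]]].
have st : (s : End V) * t = 1 := ts.
apply: (@no_uniform_nilpotency p t s p0 st).
  by move=> m hm; exact: (pm m hm).
(* On copy n of V, h acts as t^n, so by [grouplike_level] the set Z consists exactly of the powers
   of t. *)
pose h : End V := ext (fun i => ((t : End V) ^+ se i : End V) (b (fi i))).
have hE n : h * level n = (t : End V) ^+ n.
  by apply: End_eq_basis => i; rewrite EndME level_basis /h extE seK fiK.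
pose Z := @chain (End V)^c h forth back (level 0) (colevel 0) comult.
have ZP z : Z z -> exists n, z = (t : End V) ^+ n.
  move=> [x [zE xx x0 xC]].
  have [n xn] : exists n, x = level n.
    apply: grouplike_level => // f g gf gb fg; apply: (xC f g) => //.
    by rewrite -fg -[RHS]mulrA.
  by exists n; rewrite -hE -xn.
have Zn n : Z ((t : End V) ^+ n).
  exists (level n); split.
  - by rewrite -hE.
  - exact: esym (comult_level n).
  - move=> l0; apply: (@basis_neq0 (pr i0 n)).
    by rewrite -level_basis l0.
  - move=> f g gf gb fg; rewrite -[LHS]/((level n : End V) * f) -fg.
    rewrite -[RHS]/((g : End V) * level n) -diagonalP //.
    by rewrite -[in RHS]mulrA.
move=> u; have [||z [/ZP[n zE] z0]] := nil h forth back (level 0) (colevel 0) comult _ _ u.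
- exact: (Zn 0%N).
- move=> z /ZP[n ->]; rewrite -[_ * t]/((t : End V) * (t : End V) ^+ n) -exprS.
  exact: Zn.
by exists n; rewrite -zE.
Qed.

End FreeModule.

(** * Assembling the equivalence *)

Section AutEmbedding.
Variables (R : pzRingType) (V : lmodType R).

Definition Aut_End (g : Aut V) : End V := aut_fun g.

Lemma Aut_End_embedding : unit_embedding Aut_End.
Proof.
split=> //.
  by move=> g k gk; apply: Aut_ext => v; rewrite -/(Aut_End g) gk.
move=> a a' aa' a'a.
have aK : cancel (a : {linear V -> V}) (a' : {linear V -> V}).
  by move=> v; have := congr1 (fun f : End V => f v) a'a.
have a'K : cancel (a' : {linear V -> V}) (a : {linear V -> V}).
  by move=> v; have := congr1 (fun f : End V => f v) aa'.
by exists (MkAut aK a'K).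
Qed.
End AutEmbedding.

Record interpretable (A : pzRingType) : Prop := Interpretable {
  ip_half : contains_half A;
  ip_conn : no_nontrivial_central_idempotent A;
  ip_neq10 : (1 : A) <> 0;
  ip_sd : exists s0 s1 t0 t1 : A, self_double s0 s1 t0 t1;
  ip_or : oriented A;
  ip_nor : ~ oriented A^c }.

Lemma End_interpretable (R : pzRingType) (V : lmodType R) : contains_half R ->
  no_nontrivial_central_idempotent R -> free_of_infinite_rank V ->
  (1 : R) <> 0 -> interpretable (End V).
Proof.
move=> halfR connR [I [b [Iinf bP]]] R10.
have [i0 _] := infinite_setN0 Iinf.
have [pr [fi [se [prK fiK seK]]]] := infinite_times_nat Iinf.
have connE := End_connected bP i0 connR.
split=> //.
- have [h [hh hC]] := halfP halfR.
  exists (ext bP (fun i => h *: b i)); split; apply: (End_eq_basis bP) => i;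
    rewrite mulr2n EndME ?EndDE ?EndD ?extE -?scalerDl ?hh ?scale1r //.
- move=> /(congr1 (fun f : End V => f (b i0))); exact: (basis_neq0 bP R10).
- exact: (End_self_double bP prK fiK seK).
- exact: (End_oriented bP R10 prK fiK seK i0).
- exact: (End_converse_not_oriented bP R10 prK fiK seK i0 connE).
Qed.

Lemma group_to_ring_elem_equiv (A A' : pzRingType) (G G' : groupType)
    (iota : G -> A) (iota' : G' -> A') :
  unit_embedding iota -> unit_embedding iota' ->
  interpretable A -> interpretable A' ->
  group_elem_equiv G G' -> ring_elem_equiv A A'.
Proof.
move=> iP iP' ip ip' /elem_equiv_satisfies GG' phi sphi.
have [psi [spsi psiP]] := oriented_sentence.
have [s0 [s1 [t0 [t1 sd]]]] := ip_sd ip.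
have [s0' [s1' [t0' [t1' sd']]]] := ip_sd ip'.
rewrite -(satisfies_trf iP (ip_half ip) (ip_conn ip) (ip_neq10 ip) sd (ip_or ip)
  (ip_nor ip) psiP spsi sphi).
rewrite -(satisfies_trf iP' (ip_half ip') (ip_conn ip') (ip_neq10 ip') sd' (ip_or ip')
  (ip_nor ip') psiP spsi sphi).
exact: GG'.
Qed.

Lemma holds_trivial (L : language) (M N : model L) (phi : formula L) :
  (forall x y : M, x = y) -> (forall x y : N, x = y) ->
  forall (e : nat -> M) (e' : nat -> N), holds e phi <-> holds e' phi.
Proof.
move=> M1 N1; elim: phi => [t u|//|a IHa b IHb|k a IH] e e' /=.
- by split.
- by rewrite (IHa e e') (IHb e e').
- split=> h x; [apply/(IH e) | apply/(IH _ e')].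
    suff -> : e = (fun j => if j == k then e 0%N else e j) by exact: h.
    by apply/funext => j; exact: M1.
  suff -> : e' = (fun j => if j == k then e' 0%N else e' j) by exact: h.
  by apply/funext => j; exact: N1.
Qed.

Lemma elem_equiv_trivial (L : language) (M N : model L) : M -> N ->
  (forall x y : M, x = y) -> (forall x y : N, x = y) -> elementarily_equivalent M N.
Proof.
move=> x y M1 N1 phi _; split=> h e.
  exact/(holds_trivial phi M1 N1 (fun=> x) e).
exact/(holds_trivial phi M1 N1 e (fun=> y)).
Qed.

(** In a nonzero ring with 1/2 the units 1 and -1 differ, so the sentence that all elements are
    equal separates the two groups. *)
Lemma trivial_group_equiv (A' : pzRingType) (G G' : groupType) (iota' : G' -> A') :
  unit_embedding iota' -> contains_half A' -> (1 : A') <> 0 ->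
  (forall g k : G, g = k) -> ~ (group_elem_equiv G G' \/ group_elem_equiv G' G).
Proof.
move=> iP' half' n10 triv H.
have /(_ (fun n => if n == 0%N then 1%g else _)) sat :
    satisfies (group_model G') (@Equal group_language (Var 0) (Var 1)).
  by case: H => /elem_equiv_satisfies H; apply/H => e; exact: triv.
have [g gE] : exists g, iota' g = -1.
  by apply: (ue_surj iP' (b := -1)); rewrite mulrNN mulr1.
have /= g1 := sat g; apply: n10; have [h [hh _]] := halfP half'.
have m1 : -1 = 1 :> A' by rewrite -gE -g1 (ue1 iP').
by rewrite -hh -{1}[h]mulr1 -m1 mulrN1 addNr.
Qed.

Lemma trivial_scalars (R : pzRingType) (V : lmodType R) (u v : V) :
  (1 : R) = 0 -> u = v.
Proof. by move=> R0; rewrite -[u]scale1r -[v]scale1r R0 !scale0r. Qed.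

Theorem theorem14 (R S : pzRingType) (V : lmodType R) (V' : lmodType S)
    (halfR : contains_half R) (halfS : contains_half S)
    (idemR : no_nontrivial_central_idempotent R)
    (idemS : no_nontrivial_central_idempotent S)
    (freeV : free_of_infinite_rank V) (freeV' : free_of_infinite_rank V') :
  group_elem_equiv (Aut V) (Aut V') <-> ring_elem_equiv (End V) (End V').
Proof.
have iP := Aut_End_embedding V; have iP' := Aut_End_embedding V'.
split=> [eqG|]; last exact: ring_to_group_elem_equiv iP iP'.
(* The hypotheses admit zero rings, over which all endomorphisms coincide; the interpretation is
   used only when both rings are nonzero. *)
have [R0|R1] := EM ((1 : R) = 0); have [S0|S1] := EM ((1 : S) = 0).
- apply: elem_equiv_trivial; [exact: (0 : End V) | exact: (0 : End V') | |];
    by move=> f g; apply: End_ext => v; exact: trivial_scalars.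
- have ip' := End_interpretable halfS idemS freeV' S1.
  case: (trivial_group_equiv iP' (ip_half ip') (ip_neq10 ip') _ (or_introl eqG)).
  by move=> g k; apply: Aut_ext => v; exact: trivial_scalars.
- have ip := End_interpretable halfR idemR freeV R1.
  case: (trivial_group_equiv iP (ip_half ip) (ip_neq10 ip) _ (or_intror eqG)).
  by move=> g k; apply: Aut_ext => v; exact: trivial_scalars.
apply: (group_to_ring_elem_equiv iP iP') eqG; exact: End_interpretable.
Qed.
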